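(* The following are equivalent over ${\sf RCA}_0$: ${\sf ACA}_0$; $\mathsf{FC}$-1; $\mathsf{FC}$-2; $\mathsf{FC}$-3.
   Context: ${\sf RCA}_0$: basic axioms, $\Delta^0_1$ comprehension, $\Sigma^0_1$ induction; ${\sf ACA}_0$: ${\sf RCA}_0$ plus arithmetical comprehension. A countable graph is a pair $(V,E)$ with $V$ a nonempty infinite subset of $\mathbb{N}$ and $E$ a set of unordered pairs from $V$; a (connected) component is a set $C\subseteq V$ any two elements of which are joined by a finite path and which is closed under path connectedness. A set of vertices is totally disconnected if no two of its vertices lie in the same component. The canonical index of a finite set $\{a_0<a_1<\cdots<a_k\}$ is $\prod_{i\le k}p_i^{a_i}$, where $p_i$ is the $i$th prime. $\mathsf{FC}$-1: Every infinite graph in which every component is finite has a sequence $\langle d_1,d_2,\ldots\rangle$ of canonical indices of different components. $\mathsf{FC}$-2: Every infinite graph in which every component is finite has a family $\langle C_i : i\in\mathbb{N}\rangle$ of distinct connected components, given as a function $C\colon\mathbb{N}^2\to\{0,1\}$. $\mathsf{FC}$-3: Every infinite graph in which every component is finite has an infinite totally disconnected set. *)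

(* Defs.v *)
(** Reverse mathematics of graphs with finite components.

    "Equivalent over RCA_0" is rendered through logical consequence: the
    statements hold in the same L_2-structures among all models of RCA_0
    (Henkin semantics: the number sort may be nonstandard, and the set sort
    may be any family of sets).  Notions of ordinary mathematics below
    quantify only over the numbers and sets of a structure [M], so each is a
    formula of second-order arithmetic read in [M]; in particular "finite",
    "path", "prime" and "function" are the internal notions of [M]. *)

(** * Structures and formulas of second-order arithmetic *)

Record structure : Type := Structure {
  num : Type;
  sets : Type;
  sets_inhabited : inhabited sets;
  zero : num;
  one : num;
  add : num -> num -> num;
  mul : num -> num -> num;
  lt : num -> num -> Prop;
  mem : num -> sets -> Prop
}.

Arguments zero {M} : rename.
Arguments one {M} : rename.
Arguments add {M} _ _ : rename.
Arguments mul {M} _ _ : rename.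
Arguments lt {M} _ _ : rename.
Arguments mem {M} _ _ : rename.

Declare Scope so_scope.
Delimit Scope so_scope with so.
Notation "0" := zero : so_scope.
Notation "1" := one : so_scope.
Infix "+" := add : so_scope.
Infix "*" := mul : so_scope.
Infix "<" := lt : so_scope.
Notation "x <= y" := (x < y \/ x = y)%so : so_scope.
Notation "x ∈ X" := (mem x X) (at level 70, no associativity) : so_scope.
Open Scope so_scope.

(** Variables are named by natural numbers, with separate names for number
    variables and set variables.  Equality of sets is not primitive. *)

Inductive term : Type :=
| t_var (n : nat)
| t_zero
| t_one
| t_add (t u : term)
| t_mul (t u : term).

Inductive formula : Type :=
| f_eq (t u : term)
| f_lt (t u : term)
| f_mem (t : term) (X : nat)
| f_not (p : formula)
| f_and (p q : formula)
| f_or (p q : formula)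
| f_imp (p q : formula)
| f_all (n : nat) (p : formula)
| f_ex (n : nat) (p : formula)
| f_all_set (X : nat) (p : formula)
| f_ex_set (X : nat) (p : formula).

Definition update {A : Type} (e : nat -> A) (n : nat) (a : A) : nat -> A :=
  fun m => if Nat.eqb m n then a else e m.

Fixpoint eval {M : structure} (e : nat -> num M) (t : term) : num M :=
  match t with
  | t_var n => e n
  | t_zero => 0
  | t_one => 1
  | t_add t u => eval e t + eval e u
  | t_mul t u => eval e t * eval e u
  end.

Fixpoint sat {M : structure} (e : nat -> num M) (s : nat -> sets M)
    (p : formula) : Prop :=
  match p with
  | f_eq t u => eval e t = eval e u
  | f_lt t u => eval e t < eval e u
  | f_mem t X => eval e t ∈ s X
  | f_not p => ~ sat e s p
  | f_and p q => sat e s p /\ sat e s q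
  | f_or p q => sat e s p \/ sat e s q
  | f_imp p q => sat e s p -> sat e s q
  | f_all n p => forall a : num M, sat (update e n a) s p
  | f_ex n p => exists a : num M, sat (update e n a) s p
  | f_all_set X p => forall A : sets M, sat e (update s X A) p
  | f_ex_set X p => exists A : sets M, sat e (update s X A) p
  end.

Fixpoint occurs (n : nat) (t : term) : Prop :=
  match t with
  | t_var m => n = m
  | t_zero | t_one => False
  | t_add t u | t_mul t u => occurs n t \/ occurs n u
  end.

(** Sigma^0_0 formulas. *)
Inductive bounded : formula -> Prop :=
| bounded_eq t u : bounded (f_eq t u)
| bounded_lt t u : bounded (f_lt t u)
| bounded_mem t X : bounded (f_mem t X)
| bounded_not p : bounded p -> bounded (f_not p)
| bounded_and p q : bounded p -> bounded q -> bounded (f_and p q)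
| bounded_or p q : bounded p -> bounded q -> bounded (f_or p q)
| bounded_imp p q : bounded p -> bounded q -> bounded (f_imp p q)
| bounded_all n t p :
    ~ occurs n t -> bounded p ->
    bounded (f_all n (f_imp (f_lt (t_var n) t) p))
| bounded_ex n t p :
    ~ occurs n t -> bounded p ->
    bounded (f_ex n (f_and (f_lt (t_var n) t) p)).

Inductive sigma01 : formula -> Prop :=
| sigma01_ex n p : bounded p -> sigma01 (f_ex n p).

Inductive pi01 : formula -> Prop :=
| pi01_all n p : bounded p -> pi01 (f_all n p).

Fixpoint arithmetical (p : formula) : Prop :=
  match p with
  | f_eq _ _ | f_lt _ _ | f_mem _ _ => True
  | f_not p | f_all _ p | f_ex _ p => arithmetical p
  | f_and p q | f_or p q | f_imp p q => arithmetical p /\ arithmetical q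
  | f_all_set _ _ | f_ex_set _ _ => False
  end.

(** * The systems RCA_0 and ACA_0

    In the schemes, [e] and [s] are arbitrary values for the number and set
    parameters.  The new set of a comprehension axiom is chosen after [s], so
    it cannot occur in the defining formula. *)

Definition basic_axioms (M : structure) : Prop :=
  (forall n : num M, n + 1 <> 0) /\
  (forall m n : num M, m + 1 = n + 1 -> m = n) /\
  (forall m : num M, m + 0 = m) /\
  (forall m n : num M, m + (n + 1) = (m + n) + 1) /\
  (forall m : num M, m * 0 = 0) /\
  (forall m n : num M, m * (n + 1) = (m * n) + m) /\
  (forall m : num M, ~ m < 0) /\
  (forall m n : num M, m < n + 1 <-> m < n \/ m = n).

Definition sigma01_induction (M : structure) : Prop :=
  forall p : formula, sigma01 p ->
  forall (e : nat -> num M) (s : nat -> sets M) (x : nat),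
    sat (update e x 0) s p ->
    (forall a : num M, sat (update e x a) s p ->
       sat (update e x (a + 1)) s p) ->
    forall a : num M, sat (update e x a) s p.

Definition delta01_comprehension (M : structure) : Prop :=
  forall p q : formula, sigma01 p -> pi01 q ->
  forall (e : nat -> num M) (s : nat -> sets M) (x : nat),
    (forall a : num M, sat (update e x a) s p <-> sat (update e x a) s q) ->
    exists X : sets M, forall a : num M, a ∈ X <-> sat (update e x a) s p.

Definition arithmetical_comprehension (M : structure) : Prop :=
  forall p : formula, arithmetical p ->
  forall (e : nat -> num M) (s : nat -> sets M) (x : nat),
    exists X : sets M, forall a : num M, a ∈ X <-> sat (update e x a) s p.

Definition RCA0 (M : structure) : Prop :=
  basic_axioms M /\ sigma01_induction M /\ delta01_comprehension M.

Definition ACA0 (M : structure) : Prop :=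
  RCA0 M /\ arithmetical_comprehension M.

(** * Sets, pairs, functions and finite sequences inside a structure *)

Definition same_set {M : structure} (X Y : sets M) : Prop :=
  forall x, x ∈ X <-> x ∈ Y.

Definition finite {M : structure} (X : sets M) : Prop :=
  exists b, forall x, x ∈ X -> x < b.

Definition infinite {M : structure} (X : sets M) : Prop :=
  ~ finite X.

Definition pair {M : structure} (x y : num M) : num M :=
  (x + y) * (x + y) + x.

(** [f] is (the graph of) a function from [A] to [B]. *)
Definition function {M : structure} (A B : num M -> Prop) (f : sets M) : Prop :=
  (forall z, z ∈ f -> exists x y, z = pair x y /\ A x /\ B y) /\
  (forall x, A x -> exists! y, pair x y ∈ f).

Definition is_num {M : structure} (x : num M) : Prop := True.

Definition is_pair {M : structure} (x : num M) : Prop :=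
  exists i n, x = pair i n.

Definition is_bit {M : structure} (x : num M) : Prop := x = 0 \/ x = 1.

(** Finite sequences are coded by numbers through Goedel's beta function:
    item [i] of the sequence coded by [pair a b] is the remainder of [a]
    modulo [1 + (i + 1) * b].  The length is always given separately. *)
Definition item {M : structure} (s i v : num M) : Prop :=
  exists a b q,
    s = pair a b /\
    a = q * (1 + (i + 1) * b) + v /\
    v < 1 + (i + 1) * b.

(** * Canonical indices *)

Definition prime {M : structure} (p : num M) : Prop :=
  1 < p /\ forall x y : num M, p = x * y -> x = 1 \/ y = 1.

Definition next_prime {M : structure} (p q : num M) : Prop :=
  prime q /\ p < q /\ forall r, prime r -> p < r -> q <= r.

(** [p] is the [i]th prime, where 2 is the prime number zero. *)
Definition nth_prime {M : structure} (i p : num M) : Prop :=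
  exists s,
    item s 0 (1 + 1) /\
    (forall j, j < i ->
       exists u v, item s j u /\ item s (j + 1) v /\ next_prime u v) /\
    item s i p.

(** [z] is [x] to the power [y]. *)
Definition power {M : structure} (x y z : num M) : Prop :=
  exists s,
    item s 0 1 /\
    (forall j, j < y -> exists u, item s j u /\ item s (j + 1) (u * x)) /\
    item s y z.

(** [s] codes the enumeration [a_0 < ... < a_k] of the elements of [X]. *)
Definition enumerates {M : structure} (s k : num M) (X : sets M) : Prop :=
  (forall i, i < k -> exists u v, item s i u /\ item s (i + 1) v /\ u < v) /\
  (forall x, x ∈ X <-> exists i, i <= k /\ item s i x).

(** [t] codes the partial products of [p_0 ^ a_0 * ... * p_k ^ a_k]. *)
Definition canonical_index {M : structure} (X : sets M) (d : num M) : Prop :=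
  exists s k t,
    enumerates s k X /\
    item t 0 1 /\
    (forall i, i <= k -> exists a p z u,
       item s i a /\ nth_prime i p /\ power p a z /\
       item t i u /\ item t (i + 1) (u * z)) /\
    item t (k + 1) d.

(** * Graphs *)

(** The unordered pair [{x, y}] with [x < y] is coded by [pair x y]. *)
Definition adjacent {M : structure} (E : sets M) (x y : num M) : Prop :=
  (x < y /\ pair x y ∈ E) \/ (y < x /\ pair y x ∈ E).

Definition graph {M : structure} (V E : sets M) : Prop :=
  infinite V /\
  (forall e, e ∈ E ->
     exists x y, x ∈ V /\ y ∈ V /\ x < y /\ e = pair x y).

(** A path of length [n = 0] joins a vertex to itself. *)
Definition joined {M : structure} (E : sets M) (x y : num M) : Prop :=
  exists s n,
    item s 0 x /\
    (forall i, i < n ->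
       exists u v, item s i u /\ item s (i + 1) v /\ adjacent E u v) /\
    item s n y.

Definition component {M : structure} (V E C : sets M) : Prop :=
  (exists x, x ∈ C) /\
  (forall x, x ∈ C -> x ∈ V) /\
  (forall x y, x ∈ C -> y ∈ C -> joined E x y) /\
  (forall x y, x ∈ C -> joined E x y -> y ∈ C).

(** Every component is finite.  RCA_0 does not prove that each vertex lies in
    a component which is a set, so quantifying over the sets [C] that are
    components would ignore the vertices whose component is not a set. *)
Definition finite_components {M : structure} (V E : sets M) : Prop :=
  forall x, x ∈ V -> exists C, component V E C /\ x ∈ C /\ finite C.

Definition totally_disconnected {M : structure} (V E X : sets M) : Prop :=
  (forall x, x ∈ X -> x ∈ V) /\
  (forall x y, x ∈ X -> y ∈ X -> x <> y ->
     ~ exists C, component V E C /\ x ∈ C /\ y ∈ C).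

(** * The principles FC-1, FC-2 and FC-3 *)

Definition FC1 (M : structure) : Prop :=
  forall V E : sets M, graph V E -> finite_components V E ->
  exists d : sets M,
    function is_num is_num d /\
    (forall i c, pair i c ∈ d ->
       exists C, component V E C /\ canonical_index C c) /\
    (forall i j c c' C C', i <> j -> pair i c ∈ d -> pair j c' ∈ d ->
       canonical_index C c -> canonical_index C' c' -> ~ same_set C C').

Definition FC2 (M : structure) : Prop :=
  forall V E : sets M, graph V E -> finite_components V E ->
  exists F : sets M,
    function is_pair is_bit F /\
    (forall i, exists C, component V E C /\
       forall n, n ∈ C <-> pair (pair i n) 1 ∈ F) /\
    (forall i j C C', i <> j ->
       (forall n, n ∈ C <-> pair (pair i n) 1 ∈ F) ->
       (forall n, n ∈ C' <-> pair (pair j n) 1 ∈ F) ->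
       ~ same_set C C').

Definition FC3 (M : structure) : Prop :=
  forall V E : sets M, graph V E -> finite_components V E ->
  exists X : sets M, infinite X /\ totally_disconnected V E X.

(* Main.v *)
From Stdlib Require Import Arith Lia Ring Classical FunctionalExtensionality.
Require Import Defs.

(** For the reversals, let [G] be an injection of the numbers into themselves and
    join [n < m] when the value at [m] is smaller than all values on [[n, m)].
    The vertices whose tails [[n, oo)] have the minimum of [G] at the same place
    [t] form a component: it is an interval ending in [t], and all its vertices
    are adjacent to [t].  Hence for [n < m] in different components the minimum
    of [G] on [[n, oo)] is attained on [[n, m]], and a sequence of such pairs
    decides the range of [G].  FC-3 yields such pairs directly.  From FC-1 and
    FC-2 one takes the least element of the [i]th component, in the case of FC-1
    as the exponent of 2 in the canonical index; these numbers are unbounded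
    because an injection has no bound.

    Conversely, arithmetical comprehension forms the set of least elements of
    components; here symmetry and transitivity of [joined] come for free from the
    components which are assumed to exist.  Coding finite sequences relies on
    Goedel's beta function, with "coprime" replaced by "invertible modulo".

    The schemes about formulas are used through classes of predicates on
    environments closed under the logical operations, so that definability is
    proved by following the syntax of a Rocq proposition. *)

(** * Semantic definability *)

(** The ends of the components are the true stages of [G]: the places whose value is below all later
    values. An infinite set of them would decide the range of [G], so RCA_0 cannot be expected to
    produce one. A single component is harmless, since once its end is given it is a finite interval
    cut out by a bounded formula; this is why the graph satisfies [finite_components] already in
    RCA_0. A totally disconnected set need not contain any true stage, but for two of its members
    [n < m] there is one in [[n, m)], and such a bound serves as well as the place itself.

    Only Sigma^0_1 induction is available for the reversals. Hence finiteness arguments go through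
    collection and bounded Sigma^0_1 comprehension. Inductions along a coded sequence are stated for
    all numbers, with a disjunct covering those beyond its end, which keeps the induction formula
    Sigma^0_1. *)

Definition scons {A : Type} (a : A) (e : nat -> A) : nat -> A :=
  fun n => match n with O => a | S k => e k end.

Lemma scons_S {A : Type} (a : A) e n : scons a e (S n) = e n.
Proof. reflexivity. Qed.

Definition merge {A : Type} (e c : nat -> A) : nat -> A :=
  fun n => if Nat.even n then e (Nat.div2 n) else c (Nat.div2 n).

Lemma merge_even {A : Type} (e c : nat -> A) i : merge e c (2 * i) = e i.
Proof.
  unfold merge. rewrite Nat.even_even, Nat.div2_double. reflexivity.
Qed.

Lemma merge_odd {A : Type} (e c : nat -> A) i : merge e c (2 * i + 1) = c i.
Proof.
  unfold merge. rewrite Nat.even_odd.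
  replace (2 * i + 1)%nat with (S (2 * i)) by lia.
  rewrite Nat.div2_succ_double. reflexivity.
Qed.

Lemma even_odd_cases (n : nat) : exists i, n = (2 * i)%nat \/ n = (2 * i + 1)%nat.
Proof.
  destruct (Nat.Even_or_Odd n) as [[i H]|[i H]]; exists i; auto.
Qed.

Definition injective (r : nat -> nat) : Prop := forall i j, r i = r j -> i = j.

Fixpoint tren (r : nat -> nat) (t : term) : term :=
  match t with
  | t_var n => t_var (r n)
  | t_zero => t_zero
  | t_one => t_one
  | t_add t u => t_add (tren r t) (tren r u)
  | t_mul t u => t_mul (tren r t) (tren r u)
  end.

(** Bound number variables are renamed together with the free ones. With [r] injective no variable
    can be captured, so renaming replaces substitution throughout. *)
Fixpoint fren (r q : nat -> nat) (p : formula) : formula :=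
  match p with
  | f_eq t u => f_eq (tren r t) (tren r u)
  | f_lt t u => f_lt (tren r t) (tren r u)
  | f_mem t X => f_mem (tren r t) (q X)
  | f_not p => f_not (fren r q p)
  | f_and a b => f_and (fren r q a) (fren r q b)
  | f_or a b => f_or (fren r q a) (fren r q b)
  | f_imp a b => f_imp (fren r q a) (fren r q b)
  | f_all n p => f_all (r n) (fren r q p)
  | f_ex n p => f_ex (r n) (fren r q p)
  | f_all_set X p => f_all_set (q X) (fren r q p)
  | f_ex_set X p => f_ex_set (q X) (fren r q p)
  end.

Lemma eval_tren {M : structure} (e : nat -> num M) r t :
  eval e (tren r t) = eval (fun i => e (r i)) t.
Proof.
  induction t; simpl; congruence.
Qed.

Lemma update_ren {A : Type} (e : nat -> A) (r : nat -> nat) n a :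
  injective r ->
  (fun i => update e (r n) a (r i)) = update (fun i => e (r i)) n a.
Proof.
  intros Hr. apply functional_extensionality; intros i. unfold update.
  destruct (Nat.eqb_spec i n) as [->|H].
  - rewrite Nat.eqb_refl. reflexivity.
  - destruct (Nat.eqb_spec (r i) (r n)) as [E|E]; auto.
    contradiction H. exact (Hr _ _ E).
Qed.

(** Number quantifiers need [r] injective; as an arithmetical formula has no set quantifiers, [q]
    may be arbitrary. *)
Lemma sat_fren {M : structure} r q p (s : nat -> sets M) :
  injective r -> arithmetical p ->
  forall e : nat -> num M,
  sat e s (fren r q p) <-> sat (fun i => e (r i)) (fun i => s (q i)) p.
Proof.
  intros Hr; induction p; simpl; intros Hp e; rewrite ?eval_tren;
    try (rewrite IHp1, IHp2 by apply Hp); try tauto.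
  - specialize (IHp Hp e); tauto.
  - split; intros H a; specialize (H a).
    + rewrite IHp, update_ren in H by assumption. exact H.
    + rewrite IHp, update_ren by assumption. exact H.
  - split; intros [a H]; exists a.
    + rewrite IHp, update_ren in H by assumption. exact H.
    + rewrite IHp, update_ren by assumption. exact H.
Qed.

Lemma occurs_tren r n t : injective r -> occurs (r n) (tren r t) -> occurs n t.
Proof.
  intros Hr; induction t; simpl; try tauto. apply Hr.
Qed.

Lemma bounded_fren r q p : injective r -> bounded p -> bounded (fren r q p).
Proof.
  intros Hr H; induction H; simpl; constructor; auto;
    intro O; apply occurs_tren in O; auto.
Qed.

Lemma arithmetical_fren r q p : arithmetical p -> arithmetical (fren r q p).
Proof.
  induction p; simpl; tauto.
Qed.

Lemma bounded_arithmetical p : bounded p -> arithmetical p.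
Proof.
  intros H; induction H; simpl; auto.
Qed.

(** The closure properties shared by Sigma^0_0 and arithmetical formulas, so that the definability
    lemmas are proved once for both. *)
Class formula_class (K : formula -> Prop) : Prop := {
  class_arithmetical : forall p, K p -> arithmetical p;
  class_fren : forall r q p, injective r -> K p -> K (fren r q p);
  class_eq : forall t u, K (f_eq t u);
  class_lt : forall t u, K (f_lt t u);
  class_mem : forall t X, K (f_mem t X);
  class_not : forall p, K p -> K (f_not p);
  class_and : forall p q, K p -> K q -> K (f_and p q);
  class_or : forall p q, K p -> K q -> K (f_or p q);
  class_imp : forall p q, K p -> K q -> K (f_imp p q);
  class_ball : forall n t p, ~ occurs n t -> K p ->
    K (f_all n (f_imp (f_lt (t_var n) t) p));
  class_bex : forall n t p, ~ occurs n t -> K p ->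
    K (f_ex n (f_and (f_lt (t_var n) t) p))
}.

#[export] Instance bounded_class : formula_class bounded.
Proof.
  constructor; intros; try (constructor; assumption);
    auto using bounded_arithmetical, bounded_fren.
Qed.

#[export] Instance arithmetical_class : formula_class arithmetical.
Proof.
  constructor; simpl; intros; auto using arithmetical_fren.
Qed.

Section Definability.
Context {M : structure}.
Notation N := (num M).
Notation env := (nat -> num M).

Definition tail (r : env) : env := fun i => r (S i).

(** Only finitely many parameters matter, but an unrestricted supply is
    simpler: even variables are free, odd variables hold the parameters. *)
Definition Tm (t : env -> N) : Prop :=
  exists tm c, forall r, eval (merge r c) tm = t r.

Definition Def (K : formula -> Prop) (P : env -> Prop) : Prop :=
  exists p c s, K p /\ forall r, sat (merge r c) s p <-> P r.

Lemma Tm_var n : Tm (fun r => r n).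
Proof.
  exists (t_var (2 * n)), (fun _ => 0). intros r. simpl eval.
  apply merge_even.
Qed.

Lemma Tm_const (a : N) : Tm (fun _ => a).
Proof.
  exists (t_var (2 * 0 + 1)), (fun _ => a). intros r. simpl eval.
  apply (merge_odd r (fun _ => a) 0).
Qed.

(** To combine two formulas, their parameter supplies [c1] and [c2] are interleaved into
    [merge c1 c2]: parameter [i] moves from variable [2i + 1] to [4i + 1] or [4i + 3], and the free
    even variables stay in place. *)
Definition ren_left (n : nat) : nat :=
  if Nat.even n then n else (4 * Nat.div2 n + 1)%nat.
Definition ren_right (n : nat) : nat :=
  if Nat.even n then n else (4 * Nat.div2 n + 3)%nat.

Lemma div2_odd_eq (i : nat) : Nat.div2 (2 * i + 1) = i.
Proof.
  replace (2 * i + 1)%nat with (S (2 * i)) by lia. apply Nat.div2_succ_double.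
Qed.

Lemma ren_left_inj : injective ren_left.
Proof.
  intros i j. unfold ren_left.
  destruct (even_odd_cases i) as [i' [->| ->]];
  destruct (even_odd_cases j) as [j' [->| ->]];
  rewrite ?Nat.even_even, ?Nat.even_odd, ?div2_odd_eq; lia.
Qed.

Lemma ren_right_inj : injective ren_right.
Proof.
  intros i j. unfold ren_right.
  destruct (even_odd_cases i) as [i' [->| ->]];
  destruct (even_odd_cases j) as [j' [->| ->]];
  rewrite ?Nat.even_even, ?Nat.even_odd, ?div2_odd_eq; lia.
Qed.

Lemma merge_ren_left {A : Type} (r c1 c2 : nat -> A) :
  (fun i => merge r (merge c1 c2) (ren_left i)) = merge r c1.
Proof.
  apply functional_extensionality; intros n. unfold ren_left.
  destruct (even_odd_cases n) as [i [->| ->]];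
    rewrite ?Nat.even_even, ?Nat.even_odd, ?div2_odd_eq.
  - rewrite !merge_even. reflexivity.
  - replace (4 * i + 1)%nat with (2 * (2 * i) + 1)%nat by lia.
    rewrite !merge_odd, merge_even. reflexivity.
Qed.

Lemma merge_ren_right {A : Type} (r c1 c2 : nat -> A) :
  (fun i => merge r (merge c1 c2) (ren_right i)) = merge r c2.
Proof.
  apply functional_extensionality; intros n. unfold ren_right.
  destruct (even_odd_cases n) as [i [->| ->]];
    rewrite ?Nat.even_even, ?Nat.even_odd, ?div2_odd_eq.
  - rewrite !merge_even. reflexivity.
  - replace (4 * i + 3)%nat with (2 * (2 * i + 1) + 1)%nat by lia.
    rewrite !merge_odd. reflexivity.
Qed.

Lemma Tm_pair (t u : env -> N) : Tm t -> Tm u ->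
  exists a b c, forall r, eval (merge r c) a = t r /\ eval (merge r c) b = u r.
Proof.
  intros (a & c1 & Ha) (b & c2 & Hb).
  exists (tren ren_left a), (tren ren_right b), (merge c1 c2). intros r.
  rewrite !eval_tren, merge_ren_left, merge_ren_right. auto.
Qed.

Lemma Def_pair K `{formula_class K} (P Q : env -> Prop) : Def K P -> Def K Q ->
  exists p q c s, K p /\ K q /\
    forall r, (sat (merge r c) s p <-> P r) /\ (sat (merge r c) s q <-> Q r).
Proof.
  intros (p & c1 & s1 & Kp & Hp) (q & c2 & s2 & Kq & Hq).
  exists (fren ren_left (fun i => 2 * i)%nat p),
    (fren ren_right (fun i => 2 * i + 1)%nat q), (merge c1 c2), (merge s1 s2).
  pose proof ren_left_inj as Il. pose proof ren_right_inj as Ir.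
  repeat split; try (apply class_fren; assumption); intros r0;
  rewrite !sat_fren, ?merge_ren_left, ?merge_ren_right in * by
    (try apply class_arithmetical; assumption).
  all: revert r0.
  all: replace (fun i => merge s1 s2 (2 * i)) with s1 by
    (apply functional_extensionality; intros i; symmetry; apply merge_even).
  all: replace (fun i => merge s1 s2 (2 * i + 1)) with s2 by
    (apply functional_extensionality; intros i; symmetry; apply merge_odd).
  all: first [apply Hp | apply Hq].
Qed.

Lemma Tm_add t u : Tm t -> Tm u -> Tm (fun r => t r + u r).
Proof.
  intros Ht Hu. destruct (Tm_pair t u Ht Hu) as (a & b & c & H).
  exists (t_add a b), c. intros r. simpl. destruct (H r). congruence.
Qed.

Lemma Tm_mul t u : Tm t -> Tm u -> Tm (fun r => t r * u r).
Proof.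
  intros Ht Hu. destruct (Tm_pair t u Ht Hu) as (a & b & c & H).
  exists (t_mul a b), c. intros r. simpl. destruct (H r). congruence.
Qed.

Lemma Tm_pairing t u : Tm t -> Tm u -> Tm (fun r => pair (t r) (u r)).
Proof.
  intros Ht Hu. unfold pair. auto using Tm_add, Tm_mul.
Qed.

Lemma Tm_reindex t (f : nat -> nat) : Tm t -> Tm (fun r => t (fun i => r (f i))).
Proof.
  intros (a & c & H).
  exists (tren (fun n => if Nat.even n then (2 * f (Nat.div2 n))%nat else n) a), c.
  intros r. rewrite eval_tren, <- H. f_equal.
  apply functional_extensionality; intros n.
  destruct (even_odd_cases n) as [i [->| ->]];
    rewrite ?Nat.even_even, ?Nat.even_odd, ?Nat.div2_double.
  - rewrite !merge_even. reflexivity.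
  - rewrite !merge_odd. reflexivity.
Qed.

Section Class.
Context {K : formula -> Prop} {HK : formula_class K}.

Lemma Def_iff P Q : (forall r, P r <-> Q r) -> Def K P -> Def K Q.
Proof.
  intros E (p & c & s & Kp & H). exists p, c, s. split; auto.
  intros r. rewrite H. apply E.
Qed.

Lemma Def_eq (t u : env -> N) : Tm t -> Tm u -> Def K (fun r => t r = u r).
Proof.
  intros Ht Hu. destruct (sets_inhabited M) as [X].
  destruct (Tm_pair t u Ht Hu) as (a & b & c & H).
  exists (f_eq a b), c, (fun _ => X). split; [apply class_eq|].
  intros r. simpl. destruct (H r) as [-> ->]. tauto.
Qed.

Lemma Def_lt (t u : env -> N) : Tm t -> Tm u -> Def K (fun r => t r < u r).
Proof.
  intros Ht Hu. destruct (sets_inhabited M) as [X].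
  destruct (Tm_pair t u Ht Hu) as (a & b & c & H).
  exists (f_lt a b), c, (fun _ => X). split; [apply class_lt|].
  intros r. simpl. destruct (H r) as [-> ->]. tauto.
Qed.

Lemma Def_mem (t : env -> N) (X : sets M) : Tm t -> Def K (fun r => t r ∈ X).
Proof.
  intros (a & c & H). exists (f_mem a 0), c, (fun _ => X).
  split; [apply class_mem|]. intros r. simpl. rewrite H. tauto.
Qed.

Lemma Def_not P : Def K P -> Def K (fun r => ~ P r).
Proof.
  intros (p & c & s & Kp & H). exists (f_not p), c, s.
  split; [apply class_not; auto|]. intros r. simpl. rewrite H. tauto.
Qed.

Lemma Def_and P Q : Def K P -> Def K Q -> Def K (fun r => P r /\ Q r).
Proof.
  intros HP HQ. destruct (Def_pair K P Q HP HQ) as (p & q & c & s & Kp & Kq & H).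
  exists (f_and p q), c, s. split; [apply class_and; auto|].
  intros r. simpl. destruct (H r). tauto.
Qed.

Lemma Def_or P Q : Def K P -> Def K Q -> Def K (fun r => P r \/ Q r).
Proof.
  intros HP HQ. destruct (Def_pair K P Q HP HQ) as (p & q & c & s & Kp & Kq & H).
  exists (f_or p q), c, s. split; [apply class_or; auto|].
  intros r. simpl. destruct (H r). tauto.
Qed.

Lemma Def_imp P Q : Def K P -> Def K Q -> Def K (fun r => P r -> Q r).
Proof.
  intros HP HQ. destruct (Def_pair K P Q HP HQ) as (p & q & c & s & Kp & Kq & H).
  exists (f_imp p q), c, s. split; [apply class_imp; auto|].
  intros r. simpl. destruct (H r). tauto.
Qed.

Lemma Def_iff_intro P Q : Def K P -> Def K Q -> Def K (fun r => P r <-> Q r).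
Proof.
  intros HP HQ. apply Def_and; apply Def_imp; assumption.
Qed.

Lemma Def_reindex P (f : nat -> nat) :
  injective f -> Def K P -> Def K (fun r => P (fun i => r (f i))).
Proof.
  intros Hf (p & c & s & Kp & H).
  set (g := fun n => if Nat.even n then (2 * f (Nat.div2 n))%nat else n).
  assert (Hg : injective g).
  { intros i j. unfold g.
    destruct (even_odd_cases i) as [i' [->| ->]];
    destruct (even_odd_cases j) as [j' [->| ->]];
    rewrite ?Nat.even_even, ?Nat.even_odd, ?Nat.div2_double; try lia.
    intros E. rewrite (Hf i' j'); lia. }
  exists (fren g (fun i => i) p), c, s. split; [apply class_fren; auto|].
  intros r. rewrite sat_fren by (auto; apply class_arithmetical; auto).
  replace (fun i => merge r c (g i)) with (merge (fun i => r (f i)) c).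
  - apply H.
  - apply functional_extensionality; intros n. unfold g.
    destruct (even_odd_cases n) as [i [->| ->]];
    rewrite ?Nat.even_even, ?Nat.even_odd, ?Nat.div2_double.
    + rewrite !merge_even. reflexivity.
    + rewrite !merge_odd. reflexivity.
Qed.

(** The matrix is given in de Bruijn style with [r O] as the bound variable. In the formula the
    bound variable becomes number 1, the first parameter place, which is vacated by moving all
    parameters up; hence it cannot occur in the bound [a]. *)
Lemma Def_bquant (t : env -> N) (P : env -> N -> Prop) :
  Tm t -> Def K (fun r => P (tail r) (r O)) ->
  exists a p c s, K p /\ ~ occurs 1 a /\ forall r x,
    eval (update (merge r c) 1 x) a = t r /\
    (sat (update (merge r c) 1 x) s p <-> P r x).
Proof.
  intros Ht HP.
  destruct Ht as (a & c1 & Ha), HP as (p & c2 & s & Kp & Hp).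
  (* Parameter place 0 is reserved for the quantified variable. Parameter [i] of the matrix goes to
     place [2i + 1] (by [q]) and parameter [i] of the bound to place [2i + 2] (by [l]), matching
     [scons 0 (merge c2 c1)]. *)
  set (l := fun n => if Nat.even n then n else (4 * Nat.div2 n + 5)%nat).
  set (q := fun n => match n with O => 1%nat | _ =>
     if Nat.even n then (n - 2)%nat else (4 * Nat.div2 n + 3)%nat end).
  assert (Hq1 : forall i, q (2 * S i)%nat = (2 * i)%nat).
  { intros i. unfold q. replace (2 * S i)%nat with (S (S (2 * i))) by lia.
    rewrite Nat.even_succ_succ, Nat.even_even. lia. }
  assert (Hq2 : forall i, q (2 * i + 1)%nat = (4 * i + 3)%nat).
  { intros i. unfold q. destruct (2 * i + 1)%nat eqn:E; [lia|].
    rewrite <- E, Nat.even_odd, div2_odd_eq. reflexivity. }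
  assert (Hq : injective q).
  { intros i j.
    destruct (even_odd_cases i) as [[|i'] [->| ->]];
    destruct (even_odd_cases j) as [[|j'] [->| ->]];
    rewrite ?Hq1, ?Hq2; try lia; change (q (2 * 0)%nat) with 1%nat; lia. }
  exists (tren l a), (fren q (fun i => i) p), (scons 0 (merge c2 c1)), s.
  split; [apply class_fren; auto|]. split.
  { clear. induction a; simpl; try tauto. unfold l.
    destruct (Nat.even n) eqn:E; [intros <-; discriminate|].
    generalize (Nat.div2 n). intros; lia. }
  intros r x. split.
  - rewrite eval_tren, <- Ha. f_equal.
    apply functional_extensionality; intros n. unfold l.
    destruct (even_odd_cases n) as [i [->| ->]];
      rewrite ?Nat.even_even, ?Nat.even_odd, ?div2_odd_eq; unfold update.
    + destruct (Nat.eqb_spec (2 * i) 1); [lia|]. rewrite !merge_even. reflexivity.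
    + destruct (Nat.eqb_spec (4 * i + 5) 1); [lia|].
      replace (4 * i + 5)%nat with (2 * S (2 * i + 1) + 1)%nat by lia.
      rewrite !merge_odd. rewrite scons_S, merge_odd. reflexivity.
  - rewrite sat_fren by (auto; apply class_arithmetical; auto).
    replace (fun i => update (merge r (scons 0 (merge c2 c1))) 1 x (q i))
      with (merge (scons x r) c2).
    + rewrite Hp. apply iff_refl.
    + apply functional_extensionality; intros n.
      destruct (even_odd_cases n) as [[|i] [->| ->]].
      * reflexivity.
      * reflexivity.
      * rewrite Hq1, merge_even. unfold update.
        destruct (Nat.eqb_spec (2 * i) 1); [lia|]. rewrite merge_even. reflexivity.
      * rewrite Hq2, merge_odd. unfold update.
        destruct (Nat.eqb_spec (4 * S i + 3) 1); [lia|].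
        replace (4 * S i + 3)%nat with (2 * S (2 * S i) + 1)%nat by lia.
        rewrite merge_odd. rewrite scons_S, merge_even. reflexivity.
Qed.

Lemma Def_ball (t : env -> N) (P : env -> N -> Prop) :
  Tm t -> Def K (fun r => P (tail r) (r O)) ->
  Def K (fun r => forall x, x < t r -> P r x).
Proof.
  intros Ht HP. destruct (Def_bquant t P Ht HP) as (a & p & c & s & Kp & Ho & H).
  exists (f_all 1 (f_imp (f_lt (t_var 1) a) p)), c, s.
  split; [apply class_ball; auto|]. intros r. simpl.
  split; intros Hx x; specialize (Hx x); destruct (H r x) as [E F];
    rewrite E, F in *; exact Hx.
Qed.

Lemma Def_bex (t : env -> N) (P : env -> N -> Prop) :
  Tm t -> Def K (fun r => P (tail r) (r O)) ->
  Def K (fun r => exists x, x < t r /\ P r x).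
Proof.
  intros Ht HP. destruct (Def_bquant t P Ht HP) as (a & p & c & s & Kp & Ho & H).
  exists (f_ex 1 (f_and (f_lt (t_var 1) a) p)), c, s.
  split; [apply class_bex; auto|]. intros r. simpl.
  split; intros [x Hx]; exists x; destruct (H r x) as [E F];
    rewrite E, F in *; exact Hx.
Qed.

Lemma Def_quant (P : env -> N -> Prop) :
  Def K (fun r => P (tail r) (r O)) ->
  exists p c s, K p /\ forall r x,
    sat (update (merge r c) 1 x) s p <-> P r x.
Proof.
  intros HP.
  destruct (Def_bquant (fun _ => 0) P (Tm_const _) HP) as (a & p & c & s & Kp & Ho & H).
  exists p, c, s. split; auto. intros r x. apply H.
Qed.

End Class.

Lemma Def_all (P : env -> N -> Prop) :
  Def arithmetical (fun r => P (tail r) (r O)) ->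
  Def arithmetical (fun r => forall x, P r x).
Proof.
  intros HP. destruct (Def_quant P HP) as (p & c & s & Kp & H).
  exists (f_all 1 p), c, s. split; [exact Kp|]. intros r. simpl.
  split; intros Hx x; apply H; apply Hx.
Qed.

Lemma Def_ex (P : env -> N -> Prop) :
  Def arithmetical (fun r => P (tail r) (r O)) ->
  Def arithmetical (fun r => exists x, P r x).
Proof.
  intros HP. destruct (Def_quant P HP) as (p & c & s & Kp & H).
  exists (f_ex 1 p), c, s. split; [exact Kp|]. intros r. simpl.
  split; intros [x Hx]; exists x; apply H; apply Hx.
Qed.

Definition Sg (P : env -> Prop) : Prop :=
  exists Q : env -> N -> Prop, Def bounded (fun r => Q (tail r) (r O)) /\
    forall r, P r <-> exists x, Q r x.

End Definability.

Existing Class RCA0.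

Section Basics.
Context {M : structure} {HM : RCA0 M}.
Notation N := (num M).
Notation env := (nat -> num M).

Let basic : basic_axioms M := proj1 HM.

Lemma succ_ne_zero (n : N) : n + 1 <> 0. Proof. apply basic. Qed.
Lemma succ_inj (m n : N) : m + 1 = n + 1 -> m = n. Proof. apply basic. Qed.
Lemma add_0_r (m : N) : m + 0 = m. Proof. apply basic. Qed.
Lemma add_succ_r (m n : N) : m + (n + 1) = (m + n) + 1. Proof. apply basic. Qed.
Lemma mul_0_r (m : N) : m * 0 = 0. Proof. apply basic. Qed.
Lemma mul_succ_r (m n : N) : m * (n + 1) = m * n + m. Proof. apply basic. Qed.
Lemma nlt_0 (m : N) : ~ m < 0. Proof. apply basic. Qed.
Lemma lt_succ (m n : N) : m < n + 1 <-> m < n \/ m = n. Proof. apply basic. Qed.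

Lemma Def_ball_le K {HK : formula_class K} (t : env -> N) (P : env -> N -> Prop) :
  Tm t -> Def K (fun r => P (tail r) (r O)) ->
  Def K (fun r => forall x, x <= t r -> P r x).
Proof.
  intros Ht HP. apply (Def_iff (fun r => forall x, x < t r + 1 -> P r x)).
  - intros r. split; intros H x Hx; apply H, lt_succ, Hx.
  - apply Def_ball; [|exact HP]. apply Tm_add; [exact Ht|apply Tm_const].
Qed.

Lemma Def_bex_le K {HK : formula_class K} (t : env -> N) (P : env -> N -> Prop) :
  Tm t -> Def K (fun r => P (tail r) (r O)) ->
  Def K (fun r => exists x, x <= t r /\ P r x).
Proof.
  intros Ht HP. apply (Def_iff (fun r => exists x, x < t r + 1 /\ P r x)).
  - intros r. split; intros [x [Hx H]]; exists x; split; auto; apply lt_succ, Hx.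
  - apply Def_bex; [|exact HP]. apply Tm_add; [exact Ht|apply Tm_const].
Qed.

End Basics.

Ltac tm :=
  cbv beta delta [tail];
  lazymatch goal with
  | |- Tm (fun r => r _) => apply Tm_var
  | |- Tm (fun _ => ?a) => apply Tm_const
  | |- Tm (fun r => add _ _) => apply Tm_add; tm
  | |- Tm (fun r => mul _ _) => apply Tm_mul; tm
  | |- Tm (fun r => pair _ _) => apply Tm_pairing; tm
  | H : Tm ?t |- Tm ?t => exact H
  | H : Tm ?t |- Tm (fun r => ?t r) => exact H
  | H : Tm ?t |- Tm (fun r => ?t (fun i => _)) => refine (Tm_reindex t (fun i => _) H)
  end.

Create HintDb defn.
#[export] Hint Extern 1 (Tm _) => tm : defn.
#[export] Hint Extern 1 (formula_class _) => typeclasses eauto : defn.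

(** The patterns for bounded quantifiers come before the unbounded ones, which would match the same
    goals and are closed only for arithmetical formulas. *)
Ltac def1 :=
  cbv beta delta [tail];
  lazymatch goal with
  | |- Tm _ => tm
  | |- Def _ (fun r => _ = _) => apply Def_eq
  | |- Def _ (fun r => lt _ _) => apply Def_lt
  | |- Def _ (fun r => mem _ _) => apply Def_mem
  | |- Def _ (fun r => ~ _) => apply Def_not
  | |- Def _ (fun r => _ /\ _) => apply Def_and
  | |- Def _ (fun r => _ \/ _) => apply Def_or
  | |- Def _ (fun r => _ <-> _) => apply Def_iff_intro
  | |- Def _ (fun r => forall x, lt x _ -> _) => apply Def_ball
  | |- Def _ (fun r => exists x, lt x _ /\ _) => apply Def_bex
  | |- Def _ (fun r => forall x, x <= _ -> _) => apply Def_ball_le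
  | |- Def _ (fun r => exists x, x <= _ /\ _) => apply Def_bex_le
  | |- Def _ (fun r => forall x : num _, _) => apply Def_all
  | |- Def _ (fun r => exists x : num _, _) => apply Def_ex
  | |- Def _ (fun r => _ -> _) => apply Def_imp
  | |- _ => solve [auto with defn]
  end.

Ltac defn := repeat def1.

(** * Ordered semiring arithmetic from bounded induction *)

Section Arithmetic.
Context {M : structure} {HM : RCA0 M}.
Notation N := (num M).
Notation env := (nat -> num M).
Notation Bd := (Def bounded).

Lemma update_merge (r c : env) a b :
  update (update (merge r c) 2 b) 0 a = merge (scons a (scons b (tail (tail r)))) c.
Proof.
  apply functional_extensionality; intros n. unfold update.
  destruct (even_odd_cases n) as [[|[|i]] [->| ->]]; try reflexivity.
  - destruct (Nat.eqb_spec (2 * S (S i)) 0); [lia|].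
    destruct (Nat.eqb_spec (2 * S (S i)) 2); [lia|].
    rewrite !merge_even. reflexivity.
  - destruct (Nat.eqb_spec (2 * S (S i) + 1) 0); [lia|].
    destruct (Nat.eqb_spec (2 * S (S i) + 1) 2); [lia|].
    rewrite !merge_odd. reflexivity.
Qed.

Lemma Sg_ind_env (P : env -> Prop) (r : env) : Sg P ->
  P (scons 0 r) -> (forall a, P (scons a r) -> P (scons (a + 1) r)) ->
  forall a, P (scons a r).
Proof.
  intros (Q & (p & c & s & Kp & Hp) & HQ) H0 HS.
  pose proof (proj1 (proj2 HM)) as Ind.
  (* Variables 0 and 2, the first two free ones, are the witness and the induction variable; the
     zeros placed there are overwritten. *)
  set (e := merge (scons 0 (scons 0 r)) c : env).
  assert (E : forall a, sat (update e 2 a) s (f_ex 0 p) <-> P (scons a r)).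
  { intros a. simpl. rewrite HQ.
    split; intros [x Hx]; exists x; unfold e in *;
    rewrite update_merge, Hp in *; exact Hx. }
  assert (A : forall a, sat (update e 2 a) s (f_ex 0 p)).
  { apply Ind.
    - constructor; auto.
    - apply E; auto.
    - intros a Ha. apply E, HS, E, Ha. }
  intros a. apply E, A.
Qed.

Lemma Sg_ind (P : N -> Prop) : Sg (fun r => P (r O)) ->
  P 0 -> (forall a, P a -> P (a + 1)) -> forall a, P a.
Proof.
  intros H. apply (Sg_ind_env (fun r => P (r O)) (fun _ => 0) H).
Qed.

Lemma Bd_Sg (P : env -> Prop) : Bd P -> Sg P.
Proof.
  intros H. exists (fun r _ => P r). split.
  - apply (Def_reindex P S); auto. intros i j; lia.
  - intros r. split; [exists 0; auto|]. intros [? Hx]; exact Hx.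
Qed.

Lemma Bd_ind (P : N -> Prop) : Bd (fun r => P (r O)) ->
  P 0 -> (forall a, P a -> P (a + 1)) -> forall a, P a.
Proof.
  intros H. apply Sg_ind, Bd_Sg, H.
Qed.

Ltac bd_ind x :=
  revert x;
  match goal with |- forall y, @?P y => apply (Bd_ind P) end; cbv beta; [defn | |].

Lemma add_0_l (n : N) : 0 + n = n.
Proof.
  bd_ind n; [apply add_0_r|]. intros a H. rewrite add_succ_r, H. reflexivity.
Qed.

Lemma add_assoc (a b c : N) : a + (b + c) = a + b + c.
Proof.
  bd_ind c; [rewrite !add_0_r; reflexivity|].
  intros c H. rewrite !add_succ_r, H. reflexivity.
Qed.

Lemma add_1_l (n : N) : 1 + n = n + 1.
Proof.
  bd_ind n; [rewrite add_0_r, add_0_l; reflexivity|].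
  intros a H. rewrite add_succ_r, H. reflexivity.
Qed.

Lemma add_comm (a b : N) : a + b = b + a.
Proof.
  bd_ind b; [rewrite add_0_r, add_0_l; reflexivity|].
  intros b H. rewrite add_succ_r, H, <- !add_assoc, add_1_l. reflexivity.
Qed.

Lemma mul_0_l (n : N) : 0 * n = 0.
Proof.
  bd_ind n; [apply mul_0_r|]. intros a H. rewrite mul_succ_r, H. apply add_0_r.
Qed.

Lemma mul_succ_l (m n : N) : (m + 1) * n = m * n + n.
Proof.
  bd_ind n; [rewrite !mul_0_r, add_0_r; reflexivity|].
  intros n H. rewrite !mul_succ_r, H, <- !add_assoc. f_equal.
  rewrite !add_assoc, (add_comm n m). reflexivity.
Qed.

Lemma mul_comm (a b : N) : a * b = b * a.
Proof.
  bd_ind b; [rewrite mul_0_r, mul_0_l; reflexivity|].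
  intros b H. rewrite mul_succ_r, mul_succ_l, H. reflexivity.
Qed.

Lemma mul_1_l (n : N) : 1 * n = n.
Proof.
  rewrite <- (add_0_l 1), mul_succ_l, mul_0_l, add_0_l. reflexivity.
Qed.

Lemma mul_add_l (a b c : N) : (a + b) * c = a * c + b * c.
Proof.
  bd_ind c; [rewrite !mul_0_r, add_0_r; reflexivity|].
  intros c H. rewrite !mul_succ_r, H, <- !add_assoc. f_equal.
  rewrite !add_assoc, (add_comm a (b * c)). reflexivity.
Qed.

Lemma mul_assoc (a b c : N) : a * (b * c) = a * b * c.
Proof.
  bd_ind a; [rewrite !mul_0_l; reflexivity|].
  intros a H. rewrite !mul_succ_l, H, mul_add_l. reflexivity.
Qed.

Lemma num_semi_ring : semi_ring_theory (0 : N) 1 add mul eq.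
Proof.
  constructor; auto using add_0_l, add_comm, add_assoc, mul_1_l, mul_0_l,
    mul_comm, mul_assoc, mul_add_l.
Qed.
Add Ring num_ring : num_semi_ring.

Lemma add_cancel_r (a b c : N) : a + c = b + c -> a = b.
Proof.
  bd_ind c; [rewrite !add_0_r; auto|].
  intros c H E. apply H, succ_inj. rewrite <- !add_succ_r. exact E.
Qed.

Lemma add_cancel_l (a b c : N) : c + a = c + b -> a = b.
Proof.
  rewrite !(add_comm c). apply add_cancel_r.
Qed.

Lemma succ_lt_mono (m n : N) : m < n -> m + 1 < n + 1.
Proof.
  assert (H : forall x, x < n -> x + 1 < n + 1); [|exact (H m)].
  bd_ind n; [intros x Hx; destruct (nlt_0 _ Hx)|].
  intros n H x Hx. apply lt_succ in Hx as [Hx| ->].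
  - apply lt_succ. left. auto.
  - apply lt_succ. auto.
Qed.

Lemma lt_ex (m n : N) : m < n <-> exists d, n = m + d + 1.
Proof.
  split.
  (* Both [x] and [d] are bounded by [n] to make the induction formula Sigma^0_0; closure of [Sg]
     under quantifiers itself rests on this arithmetic. *)
  - intros Hm. assert (H : forall x, x < n -> exists d, d < n /\ n = x + d + 1).
    { clear Hm. bd_ind n; [intros x Hx; destruct (nlt_0 _ Hx)|].
      intros n H x Hx. apply lt_succ in Hx as [Hx| ->].
      - destruct (H x Hx) as (d & Hd & E). exists (d + 1).
        split; [apply succ_lt_mono, Hd|]. rewrite E at 1. ring.
      - exists 0. split; [|ring].
        assert (Z : forall n : N, 0 < n + 1); [|apply Z].
        intros k; bd_ind k; intros; apply lt_succ; auto. }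
    destruct (H m Hm) as (d & _ & E); eauto.
  - intros [d ->]. bd_ind d; [apply lt_succ; right; ring|].
    intros d H. apply lt_succ. left. rewrite add_assoc. exact H.
Qed.

Lemma le_ex (m n : N) : m <= n <-> exists d, n = m + d.
Proof.
  split.
  - intros [H| ->]; [|exists 0; ring].
    apply lt_ex in H as [d ->]. exists (d + 1). ring.
  - intros [d ->]. apply lt_succ, lt_ex. exists d. reflexivity.
Qed.

Lemma lt_irrefl (n : N) : ~ n < n.
Proof.
  intros H. apply lt_ex in H as [d H]. apply (succ_ne_zero d).
  apply (add_cancel_l _ _ n). rewrite add_0_r, add_assoc. auto.
Qed.

Lemma lt_trans (a b c : N) : a < b -> b < c -> a < c.
Proof.
  rewrite !lt_ex. intros [d ->] [e ->]. exists (d + 1 + e). ring.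
Qed.

Lemma lt_succ_diag (a : N) : a < a + 1.
Proof. apply lt_succ. auto. Qed.

Lemma le_0 (n : N) : 0 <= n.
Proof. apply le_ex. exists n. ring. Qed.

Lemma trichotomy (m n : N) : m < n \/ m = n \/ n < m.
Proof.
  bd_ind m.
  - destruct (le_0 n); auto.
  - intros m [H|[->|H]].
    + apply succ_lt_mono, lt_succ in H as [H|E]; auto.
    + right; right. apply lt_succ_diag.
    + right; right. apply lt_succ; auto.
Qed.

Lemma zero_or_succ (n : N) : n = 0 \/ exists m, n = m + 1.
Proof.
  destruct (le_0 n) as [H|H]; auto.
  right. apply lt_ex in H as [d ->]. exists d. ring.
Qed.

End Arithmetic.

Ltac new_lt x y H :=
  lazymatch goal with
  | _ : lt x y |- _ => fail
  | _ => assert (lt x y) by exact H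
  end.

Ltac order_hyp :=
  match goal with
  | H : ?x < ?x |- _ => exfalso; exact (lt_irrefl _ H)
  | H : _ /\ _ |- _ => destruct H
  | H : ?x < 0 |- _ => exfalso; exact (nlt_0 _ H)
  | H : @eq (num _) ?x ?x |- _ => clear H
  | H : @eq (num _) ?x ?y |- _ => subst x || subst y
  | H : ~ (_ \/ _) |- _ => apply not_or_and in H; destruct H
  | H : ~ (?x < ?y) |- _ =>
      destruct (trichotomy x y) as [?|[?|?]]; [contradiction|clear H|clear H]
  | H : ~ (?x = ?y) |- _ =>
      destruct (trichotomy x y) as [?|[?|?]]; [clear H|contradiction|clear H]
  | H : _ < _ \/ _ = _ |- _ => destruct H
  | H : _ < _ + 1 |- _ => apply lt_succ in H
  end.

Ltac order_succ :=
  match goal with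
  | _ : lt _ (?x + 1) |- _ => new_lt x (x + 1) (lt_succ_diag x)
  | _ : lt (?x + 1) _ |- _ => new_lt x (x + 1) (lt_succ_diag x)
  | _ : _ = ?x + 1 |- _ => new_lt x (x + 1) (lt_succ_diag x)
  | _ : ?x + 1 = _ |- _ => new_lt x (x + 1) (lt_succ_diag x)
  end.

Ltac order_trans :=
  match goal with
  | H : ?x < ?x |- _ => exfalso; exact (lt_irrefl _ H)
  | H1 : ?x < ?y, H2 : ?y < ?z |- _ => new_lt x z (lt_trans x y z H1 H2)
  | H1 : @eq (num _) ?x ?y, H2 : ?y < ?z |- _ =>
      new_lt x z (eq_ind_r (fun w => w < z) H2 H1)
  | H1 : @eq (num _) ?x ?y, H2 : ?z < ?y |- _ =>
      new_lt z x (eq_ind_r (fun w => z < w) H2 H1)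
  | H1 : @eq (num _) ?x ?y, H2 : ?x < ?z |- _ =>
      new_lt y z (eq_ind x (fun w => w < z) H2 y H1)
  | H1 : @eq (num _) ?x ?y, H2 : ?z < ?x |- _ =>
      new_lt z y (eq_ind x (fun w => z < w) H2 y H1)
  end.

(** Decides linear-order goals, with [x + 1] as the successor of [x]. *)
Ltac order :=
  intros;
  try (match goal with |- False => fail 1 | |- ~ _ => intro | _ => apply NNPP; intro end);
  solve [repeat order_hyp; repeat order_succ; repeat order_trans].

(** * Closure of Sigma^0_1, and the induction, collection, least number and comprehension schemes *)

Section Schemes.
Context {M : structure} {HM : RCA0 M}.
Notation N := (num M).
Notation env := (nat -> num M).
Notation Bd := (Def bounded).
Add Ring num_ring : (num_semi_ring (M := M)).

(** Weakenings: the variable skipped is the common bound on witnesses that is inserted when several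
    existential quantifiers are merged into one. *)
Definition drop1 (n : nat) : nat := match n with O => O | S i => S (S i) end.
Definition drop2 (n : nat) : nat :=
  match n with O => O | 1%nat => 1%nat | S (S i) => S (S (S i)) end.

Lemma drop1_inj : injective drop1.
Proof. intros [|i] [|j]; simpl; lia. Qed.

Lemma drop2_inj : injective drop2.
Proof. intros [|[|i]] [|[|j]]; simpl; lia. Qed.

Lemma Bd_drop1 (Q : env -> N -> Prop) : Bd (fun r => Q (tail r) (r O)) ->
  Bd (fun r => Q (tail (tail r)) (r O)).
Proof.
  intros H. exact (Def_reindex _ drop1 drop1_inj H).
Qed.

Lemma scons_eta (r : env) : scons (r O) (tail r) = r.
Proof.
  apply functional_extensionality; intros [|n]; reflexivity.
Qed.

Lemma Bd_scons (Q : env -> N -> Prop) : Bd (fun r => Q (tail r) (r O)) ->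
  Bd (fun r => Q (scons (r 1%nat) (tail (tail r))) (r O)).
Proof.
  apply Def_iff. intros r. change (r 1%nat) with (tail r O).
  rewrite scons_eta. tauto.
Qed.

Lemma Bd_drop2 (Q : env -> N -> Prop) : Bd (fun r => Q (tail r) (r O)) ->
  Bd (fun r => Q (scons (r 1%nat) (tail (tail (tail r)))) (r O)).
Proof.
  intros H. apply (Def_reindex _ drop2 drop2_inj (Bd_scons Q H)).
Qed.

Lemma Sg_iff (P Q : env -> Prop) : (forall r, P r <-> Q r) -> Sg P -> Sg Q.
Proof.
  intros E (R & HR & H). exists R. split; auto. intros r. rewrite <- E. apply H.
Qed.

Lemma Sg_or (P Q : env -> Prop) : Sg P -> Sg Q -> Sg (fun r => P r \/ Q r).
Proof.
  intros (A & HA & EA) (B & HB & EB).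
  exists (fun r x => A r x \/ B r x). split; [defn; assumption|].
  intros r. rewrite EA, EB. split.
  - intros [[x H]|[x H]]; exists x; auto.
  - intros [x [H|H]]; eauto.
Qed.

Lemma Sg_and (P Q : env -> Prop) : Sg P -> Sg Q -> Sg (fun r => P r /\ Q r).
Proof.
  intros (A & HA & EA) (B & HB & EB).
  exists (fun r c => (exists x, x < c /\ A r x) /\ (exists x, x < c /\ B r x)).
  split.
  - apply Def_and; apply Def_bex; try tm; apply Bd_drop1; assumption.
  - intros r. rewrite EA, EB. split.
    + intros [[x Hx] [y Hy]]. exists (x + y + 1).
      split; [exists x|exists y]; split; auto; apply lt_succ, le_ex;
        [exists y|exists x]; ring.
    + intros (c & (x & _ & Hx) & (y & _ & Hy)). eauto.
Qed.

Lemma Sg_ex (P : env -> N -> Prop) : Sg (fun r => P (tail r) (r O)) ->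
  Sg (fun r => exists x, P r x).
Proof.
  intros (Q & HQ & E).
  exists (fun r c => exists x, x < c /\ exists y, y < c /\ Q (scons x r) y).
  split.
  - apply Def_bex; [tm|]. apply Def_bex; [tm|]. exact (Bd_drop2 Q HQ).
  - intros r. split.
    + intros [x Hx]. apply (E (scons x r)) in Hx as [y Hy].
      exists (x + y + 1). exists x. split; [apply lt_succ, le_ex; exists y; ring|].
      exists y. split; auto. apply lt_succ, le_ex. exists x. ring.
    + intros (c & x & _ & y & _ & H). exists x. apply (E (scons x r)). eauto.
Qed.

(** This is Sigma^0_1 collection: the bounded quantifier moves inside once the witnesses for all
    [x < t r] have a common bound [c], and such a bound for [x < n] is found by Sigma^0_1 induction
    on [n]. *)
Lemma Sg_ball (t : env -> N) (P : env -> N -> Prop) :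
  Tm t -> Sg (fun r => P (tail r) (r O)) ->
  Sg (fun r => forall x, x < t r -> P r x).
Proof.
  intros Ht (Q & HQ & E).
  exists (fun r c => forall x, x < t r -> exists y, y < c /\ Q (scons x r) y).
  split.
  - apply Def_ball; [tm|]. apply Def_bex; [tm|]. exact (Bd_drop2 Q HQ).
  - intros r. split.
    + intros H.
      (* The first disjunct covers [n] beyond [t r], so that the hypothesis is called upon only
         below [t r] although the induction runs over all numbers. *)
      set (C := fun r : env => t (tail r) < r O \/
        exists c, forall x, x < r O -> exists y, y < c /\ Q (scons x (tail r)) y).
      assert (HC : Sg C).
      { apply Sg_or; [apply Bd_Sg; defn|].
        exists (fun r c => forall x, x < r O -> exists y, y < c /\ Q (scons x (tail r)) y).
        split; [|intros; tauto].
        apply Def_ball; [tm|]. apply Def_bex; [tm|].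
        apply (Def_reindex _ (fun n => match n with O => O | 1%nat => 1%nat
          | S (S i) => S (S (S (S i))) end)) in HQ.
        - revert HQ. apply Def_iff. intros r0.
          match goal with |- Q ?a _ <-> Q ?b _ => replace b with a; [tauto|] end.
          apply functional_extensionality; intros [|n]; reflexivity.
        - intros [|[|i]] [|[|j]]; simpl; lia. }
      assert (A : forall n, C (scons n r)).
      { apply (Sg_ind_env C r HC).
        - right. exists 0. intros x Hx. destruct (nlt_0 _ Hx).
        - intros n [Hn|[c Hc]]; [left|].
          + change (t r < n) in Hn. change (t r < n + 1). order.
          + destruct (classic (n < t r)) as [Hn|Hn].
            * right. apply H, (E (scons n r)) in Hn as [y Hy].
              exists (c + y + 1). intros x Hx. simpl in Hx.
              apply lt_succ in Hx as [Hx| ->].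
              -- destruct (Hc x Hx) as (z & Hz & Qz). exists z. split; auto.
                 apply lt_ex in Hz as [d ->]. apply lt_ex. exists (d + 1 + y). ring.
              -- exists y. split; auto. apply lt_ex. exists c. ring.
            * left. change (t r < n + 1). order. }
      destruct (A (t r)) as [C1|C1]; [destruct (lt_irrefl _ C1)|exact C1].
    + intros [c Hc] x Hx. apply Hc in Hx as (y & _ & Hy).
      apply (E (scons x r)). eauto.
Qed.

Lemma Sg_imp (P Q : env -> Prop) : Bd P -> Sg Q -> Sg (fun r => P r -> Q r).
Proof.
  intros HP HQ. apply (Sg_iff (fun r => ~ P r \/ Q r)).
  - intros r. split; [tauto|]. intros H. destruct (classic (P r)); auto.
  - apply Sg_or; auto. apply Bd_Sg. defn; auto.
Qed.

Lemma Sg_ball_le (t : env -> N) (P : env -> N -> Prop) :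
  Tm t -> Sg (fun r => P (tail r) (r O)) ->
  Sg (fun r => forall x, x <= t r -> P r x).
Proof.
  intros Ht HP. apply (Sg_iff (fun r => forall x, x < t r + 1 -> P r x)).
  - intros r. split; intros H x Hx; apply H, lt_succ, Hx.
  - apply Sg_ball; [tm|exact HP].
Qed.

(** Renaming can only replace variables by variables. Terms are put in by quantifying over numbers
    equal to them, with the terms themselves as bounds. *)
Lemma Def_subst2 K {HK : formula_class K} (P : N -> N -> Prop) t u :
  Def K (fun r => P (r O) (r 1%nat)) -> Tm t -> Tm u ->
  Def K (fun r => P (t r) (u r)).
Proof.
  intros HP Ht Hu.
  apply (Def_iff (fun r => exists y, y < u r + 1 /\ (y = u r /\
    exists x, x < t r + 1 /\ (x = t r /\ P x y)))).
  - intros r. split; [intros (y & _ & -> & x & _ & -> & H); exact H|].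
    intros H. exists (u r). do 2 (split; auto using lt_succ_diag).
    exists (t r). auto using lt_succ_diag.
  - defn.
Qed.

Lemma collection (P : N -> N -> Prop) n : Sg (fun r => P (r 1%nat) (r O)) ->
  (forall x, x < n -> exists y, P x y) ->
  exists b, forall x, x < n -> exists y, y < b /\ P x y.
Proof.
  intros HP H.
  assert (A : forall m, n < m \/ exists b, forall x, x < m -> exists y, y < b /\ P x y).
  { apply Sg_ind.
    - apply Sg_or; [apply Bd_Sg; defn|]. apply Sg_ex, Sg_ball; [tm|].
      apply Sg_ex, Sg_and; [apply Bd_Sg; defn|exact HP].
    - right. exists 0. intros x Hx. destruct (nlt_0 _ Hx).
    - intros m [Hm|[b Hb]]; [left; order|].
      destruct (classic (m < n)) as [Hm|Hm]; [right|left; order].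
      apply H in Hm as [y Hy]. exists (b + y + 1). intros x Hx.
      apply lt_succ in Hx as [Hx| ->].
      + destruct (Hb x Hx) as (z & Hz & Qz). exists z. split; auto.
        apply lt_ex in Hz as [d ->]. apply lt_ex. exists (d + 1 + y). ring.
      + exists y. split; auto. apply lt_ex. exists b. ring. }
  destruct (A n) as [C|C]; [destruct (lt_irrefl _ C)|exact C].
Qed.

Lemma least_Pi (P : N -> Prop) a : Sg (fun r => ~ P (r O)) -> P a ->
  exists m, P m /\ forall x, x < m -> ~ P x.
Proof.
  intros HP Ha. apply NNPP. intros H.
  assert (A : forall n x, x < n -> ~ P x).
  { apply (Sg_ind (fun n => forall x, x < n -> ~ P x)).
    - apply Sg_ball; [tm|exact HP].
    - intros x Hx. destruct (nlt_0 _ Hx).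
    - intros n Hn x Hx Px. apply lt_succ in Hx as [Hx| ->]; [exact (Hn x Hx Px)|].
      apply H. exists n. auto. }
  exact (A (a + 1) a (lt_succ_diag a) Ha).
Qed.

(** A counterexample [a] is pushed downwards: if [P] fails at [m + 1] it fails at [m]. That it fails
    at distance [n] below [a] is a Sigma^0_1 statement about [n], absurd at [n = a + 1]. *)
Lemma Pi_ind (P : N -> Prop) : Sg (fun r => ~ P (r O)) ->
  P 0 -> (forall a, P a -> P (a + 1)) -> forall a, P a.
Proof.
  intros HP H0 HS a. apply NNPP. intros Ha.
  assert (A : forall n, exists z, z + n = a /\ ~ P z).
  { apply Sg_ind.
    - apply Sg_ex, Sg_and; [apply Bd_Sg; defn|exact HP].
    - exists a. split; auto. ring.
    - intros n (z & E & Hz). destruct (zero_or_succ z) as [->|[m ->]]; [tauto|].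
      exists m. split; auto. rewrite <- E. ring. }
  destruct (A (a + 1)) as (z & E & _). apply (succ_ne_zero z).
  apply (add_cancel_r _ _ a). rewrite add_0_l. etransitivity; [|exact E]. ring.
Qed.

Lemma least_Sg (P : N -> Prop) a : Sg (fun r => P (r O)) -> P a ->
  exists m, P m /\ forall x, x < m -> ~ P x.
Proof.
  intros HP Ha. apply NNPP. intros H.
  assert (A : forall n x, x < n -> ~ P x).
  { apply (Pi_ind (fun n => forall x, x < n -> ~ P x)).
    - apply (Sg_iff (fun r => exists x, x < r O /\ P x)).
      + intros r. split.
        * intros (x & Hx & Px) C. exact (C x Hx Px).
        * intros C. apply NNPP. intros D. apply C. intros x Hx Px. eauto.
      + apply Sg_ex, Sg_and; [apply Bd_Sg; defn|exact HP].
    - intros x Hx. destruct (nlt_0 _ Hx).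
    - intros n Hn x Hx Px. apply lt_succ in Hx as [Hx| ->]; [exact (Hn x Hx Px)|].
      apply H. exists n. auto. }
  exact (A (a + 1) a (lt_succ_diag a) Ha).
Qed.

Lemma Sg_comprehension (P : N -> Prop) :
  Sg (fun r => P (r O)) -> Sg (fun r => ~ P (r O)) ->
  exists X : sets M, forall a, a ∈ X <-> P a.
Proof.
  intros (A & HA & EA) (B & HB & EB).
  destruct (Def_pair _ _ _ HA HB) as (p & q & c & s & Kp & Kq & H).
  set (e := merge (fun _ => 0) c : env).
  assert (E : forall a, sat (update e 2 a) s (f_ex 0 p) <-> P a).
  { intros a. simpl. rewrite (EA (scons a (tail (tail (fun _ => 0))))).
    split; intros [x Hx]; exists x; unfold e in *;
    rewrite update_merge in *; apply (proj1 (H _)) in Hx || apply (proj1 (H _)); exact Hx. }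
  destruct (proj2 (proj2 HM) (f_ex 0 p) (f_all 0 (f_not q))
    ltac:(constructor; auto) ltac:(constructor; constructor; auto) e s 2%nat)
    as [X HX].
  - intros a. rewrite E. simpl.
    assert (F : (exists x, sat (update (update e 2 a) 0 x) s q) <-> ~ P a).
    { rewrite (EB (scons a (tail (tail (fun _ => 0))))).
      split; intros [x Hx]; exists x; unfold e in *;
      rewrite update_merge in *; apply (proj2 (H _)) in Hx || apply (proj2 (H _)); exact Hx. }
    split.
    + intros Pa x Hx. apply F; eauto.
    + intros C. apply NNPP. intros nP. apply F in nP as [x Hx]. exact (C x Hx).
  - exists X. intros a. rewrite HX. apply E.
Qed.

Lemma Bd_comprehension (P : N -> Prop) : Bd (fun r => P (r O)) ->
  exists X : sets M, forall a, a ∈ X <-> P a.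
Proof.
  intros H. apply Sg_comprehension; apply Bd_Sg; auto. defn; auto.
Qed.

Lemma Ar_comprehension (P : N -> Prop) : arithmetical_comprehension M ->
  Def arithmetical (fun r => P (r O)) ->
  exists X : sets M, forall a, a ∈ X <-> P a.
Proof.
  intros AC (p & c & s & Kp & Hp).
  destruct (AC p Kp (merge (fun _ => 0) c) s O) as [X HX].
  exists X. intros a. rewrite HX, <- (Hp (scons a (fun _ => 0))).
  match goal with |- sat ?e _ _ <-> sat ?f _ _ => replace f with e; [tauto|] end.
  apply functional_extensionality; intros n. unfold update.
  destruct (even_odd_cases n) as [[|i] [->| ->]]; try reflexivity.
  - destruct (Nat.eqb_spec (2 * S i) 0); [lia|]. rewrite !merge_even. reflexivity.
  - destruct (Nat.eqb_spec (2 * S i + 1) 0); [lia|]. rewrite !merge_odd. reflexivity.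
Qed.

Lemma Ar_ind (P : N -> Prop) : arithmetical_comprehension M ->
  Def arithmetical (fun r => P (r O)) ->
  P 0 -> (forall a, P a -> P (a + 1)) -> forall a, P a.
Proof.
  intros AC HP H0 HS. destruct (Ar_comprehension P AC HP) as [X HX].
  intros a. apply HX. revert a. apply Bd_ind; [defn|apply HX, H0|].
  intros a. rewrite !HX. apply HS.
Qed.

Lemma least_Ar (P : N -> Prop) a : arithmetical_comprehension M ->
  Def arithmetical (fun r => P (r O)) -> P a ->
  exists m, P m /\ forall x, x < m -> ~ P x.
Proof.
  intros AC HP Ha. destruct (Ar_comprehension P AC HP) as [X HX].
  destruct (least_Sg (fun x => x ∈ X) a) as (m & Hm & H).
  - apply Bd_Sg. defn.
  - apply HX, Ha.
  - exists m. rewrite <- HX. split; auto. intros x Hx. rewrite <- HX. auto.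
Qed.

End Schemes.

Ltac sg1 :=
  cbv beta delta [tail];
  first [ solve [auto with defn] |
  lazymatch goal with
  | |- Tm _ => tm
  | |- Sg (fun r => _ /\ _) => apply Sg_and
  | |- Sg (fun r => _ \/ _) => apply Sg_or
  | |- Sg (fun r => forall x, lt x _ -> _) => apply Sg_ball
  | |- Sg (fun r => forall x, x <= _ -> _) => apply Sg_ball_le
  | |- Sg (fun r => exists x : num _, _) => apply Sg_ex
  | |- Sg (fun r => forall x : num _, _) => fail
  | |- Sg (fun r => ~ _) => apply Bd_Sg; defn
  | |- Sg (fun r => _ -> _) => apply Sg_imp; [defn|]
  | |- Sg _ => apply Bd_Sg; defn
  end].
Ltac sgdef := repeat sg1.

(** * Pairs, congruences and the beta function *)

Section Coding.
Context {M : structure} {HM : RCA0 M}.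
Notation N := (num M).
Notation env := (nat -> num M).
Notation Bd := (Def bounded).
Add Ring num_ring : (num_semi_ring (M := M)).

Lemma add_eq_0 (a b : N) : a + b = 0 -> a = 0.
Proof.
  intros H. destruct (zero_or_succ a) as [->|[m ->]]; auto.
  destruct (succ_ne_zero (m + b)). rewrite <- H. ring.
Qed.

Lemma le_add_l (a b : N) : a <= a + b.
Proof. apply le_ex. eauto. Qed.

Lemma le_add_r (a b : N) : b <= a + b.
Proof. apply le_ex. exists a. ring. Qed.

Lemma le_trans (a b c : N) : a <= b -> b <= c -> a <= c.
Proof. order. Qed.

Lemma lt_le_trans (a b c : N) : a < b -> b <= c -> a < c.
Proof. order. Qed.

Lemma le_lt_trans (a b c : N) : a <= b -> b < c -> a < c.
Proof. order. Qed.

Lemma le_mul_l (a b : N) : b <> 0 -> a <= a * b.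
Proof.
  intros H. destruct (zero_or_succ b) as [->|[m ->]]; [tauto|].
  apply le_ex. exists (a * m). ring.
Qed.

Lemma le_square (a : N) : a <= a * a.
Proof.
  destruct (zero_or_succ a) as [->|[m ->]].
  - right. ring.
  - apply le_mul_l, succ_ne_zero.
Qed.

(** Since [x <= x + y], the code lies between the squares of [x + y] and of its successor, so it
    determines [x + y], and then [x]. *)
Lemma pair_inj (x y x' y' : N) : pair x y = pair x' y' -> x = x' /\ y = y'.
Proof.
  assert (L : forall x y x' y' : N, x + y < x' + y' -> pair x y <> pair x' y').
  { clear - HM. intros x y x' y' H E. unfold pair in E.
    apply lt_ex in H as [d H]. rewrite H in E.
    apply (succ_ne_zero (y + y * (d + d + 1) + x * (d + d + 1) + d + d + d * d + x')).
    apply (add_cancel_l _ _ ((x + y) * (x + y) + x)).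
    rewrite add_0_r. etransitivity; [|symmetry; exact E]. ring. }
  intros E. destruct (trichotomy (x + y) (x' + y')) as [H|[H|H]].
  - destruct (L _ _ _ _ H E).
  - unfold pair in E. rewrite H in E. apply add_cancel_l in E. subst x'.
    apply add_cancel_l in H. auto.
  - destruct (L _ _ _ _ H (eq_sym E)).
Qed.

Lemma le_pair_l (x y : N) : x <= pair x y.
Proof. apply le_add_r. Qed.

Lemma le_pair_r (x y : N) : y <= pair x y.
Proof.
  apply (le_trans _ (x + y)); [apply le_add_r|].
  apply (le_trans _ _ _ (le_square _)), le_add_l.
Qed.

Definition modulus (b i : N) : N := 1 + (i + 1) * b.

(** The modulus is at least 1, so [a], [b] and the quotient [q] are all at most the code, and
    decoding is Sigma^0_0. *)
Lemma Def_item K {HK : formula_class K} (t u w : env -> N) :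
  Tm t -> Tm u -> Tm w -> Def K (fun r => item (t r) (u r) (w r)).
Proof.
  intros Ht Hu Hw. apply (Def_iff (fun r =>
    exists a, a <= t r /\ exists b, b <= t r /\ exists q, q <= t r /\
      (t r = pair a b /\ a = q * (1 + (u r + 1) * b) + w r /\
       w r < 1 + (u r + 1) * b))).
  - intros r. unfold item. split.
    + intros (a & _ & b & _ & q & _ & H). eauto.
    + intros (a & b & q & E & Ea & H). exists a.
      assert (La : a <= t r) by (rewrite E; apply le_pair_l).
      split; auto. exists b. split; [rewrite E; apply le_pair_r|].
      exists q. split; auto. apply (le_trans _ a); auto. rewrite Ea.
      apply le_ex. exists (q * (u r + 1) * b + w r). ring.
  - defn.
Qed.

Lemma item_le (s i v : N) : item s i v -> v <= s.
Proof.
  intros (a & b & q & -> & -> & _).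
  apply (le_trans _ _ _ (le_add_r _ _) (le_pair_l _ _)).
Qed.

Lemma item_unique (s i v w : N) : item s i v -> item s i w -> v = w.
Proof.
  intros (a & b & q & -> & Ea & Hv) (a' & b' & q' & E & Ea' & Hw).
  apply pair_inj in E as [<- <-]. set (m := 1 + (i + 1) * b) in *.
  clearbody m. rewrite Ea in Ea'. clear Ea a.
  assert (L : forall q q' v w : N, q < q' -> v < m -> q * m + v <> q' * m + w).
  { clear - HM. intros q q' v w H Hv E. apply lt_ex in H as [d ->].
    replace ((q + d + 1) * m + w) with (q * m + (m + (d * m + w))) in E by ring.
    apply add_cancel_l in E. pose proof (le_add_l m (d * m + w)). order. }
  destruct (trichotomy q q') as [H|[->|H]].
  - destruct (L _ _ _ _ H Hv Ea').
  - exact (add_cancel_l _ _ _ Ea').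
  - destruct (L _ _ _ _ H Hw (eq_sym Ea')).
Qed.

(** Congruence without subtraction: multiples of [m] may be added on either side. *)
Definition cong (m a b : N) : Prop := exists u v, a + m * u = b + m * v.

Lemma cong_refl m a : cong m a a.
Proof. exists 0, 0. reflexivity. Qed.

Lemma cong_sym m a b : cong m a b -> cong m b a.
Proof. intros (u & v & E). exists v, u. auto. Qed.

Lemma cong_trans m a b c : cong m a b -> cong m b c -> cong m a c.
Proof.
  intros (u & v & E) (u' & v' & E'). exists (u + u'), (v + v').
  replace (a + m * (u + u')) with (a + m * u + m * u') by ring. rewrite E.
  replace (b + m * v + m * u') with (b + m * u' + m * v) by ring. rewrite E'. ring.
Qed.

Lemma cong_add m a b c d : cong m a b -> cong m c d -> cong m (a + c) (b + d).
Proof.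
  intros (u & v & E) (u' & v' & E'). exists (u + u'), (v + v').
  replace (a + c + m * (u + u')) with ((a + m * u) + (c + m * u')) by ring.
  rewrite E, E'. ring.
Qed.

Lemma cong_mul m a b c d : cong m a b -> cong m c d -> cong m (a * c) (b * d).
Proof.
  intros (u & v & E) (u' & v' & E').
  exists (a * u' + u * c + m * u * u'), (b * v' + v * d + m * v * v').
  transitivity ((a + m * u) * (c + m * u')); [ring|]. rewrite E, E'. ring.
Qed.

Lemma cong_mult m a q : cong m (a + m * q) a.
Proof. exists 0, q. ring. Qed.

Lemma cong_lt m a v : cong m a v -> v < m -> exists q, a = q * m + v.
Proof.
  intros (u & w & E) Hv. destruct (trichotomy u w) as [H|[->|H]].
  - apply lt_ex in H as [d ->]. exists (d + 1).
    apply (add_cancel_r _ _ (m * u)). rewrite E. ring.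
  - exists 0. rewrite mul_0_l, add_0_l. exact (add_cancel_r _ _ _ E).
  - apply lt_ex in H as [d ->].
    assert (E' : v = m + (a + m * d)).
    { apply (add_cancel_r _ _ (m * w)). rewrite <- E. ring. }
    pose proof (le_add_l m (a + m * d)). order.
Qed.

(** Inverses multiply, which gives closure under products at once, and the inverse itself is what
    the Chinese remainder step uses. *)
Definition invertible (m a : N) : Prop := exists x, cong m (a * x) 1.

Lemma invertible_mul m a b : invertible m a -> invertible m b -> invertible m (a * b).
Proof.
  intros [x Hx] [y Hy]. exists (x * y).
  replace (a * b * (x * y)) with ((a * x) * (b * y)) by ring.
  apply (cong_trans _ _ (1 * 1)); [apply cong_mul; assumption|].
  rewrite mul_1_l. apply cong_refl.
Qed.

Lemma invertible_divides m a n : invertible m a -> 0 < m ->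
  (exists q, a * n = m * q) -> exists q, n = m * q.
Proof.
  intros [x Hx] Hm [q Hq]. destruct (cong_lt m n 0) as [k ->]; auto.
  - apply (cong_trans _ _ (a * x * n)).
    + apply cong_sym. apply (cong_trans _ _ (1 * n)).
      * apply cong_mul; auto using cong_refl.
      * rewrite mul_1_l. apply cong_refl.
    + replace (a * x * n) with (0 + m * (q * x)); [apply cong_mult|].
      transitivity (a * n * x); [rewrite Hq|]; ring.
  - exists k. ring.
Qed.

Lemma modulus_pos (b i : N) : 0 < modulus b i.
Proof. unfold modulus. apply lt_ex. exists ((i + 1) * b). ring. Qed.

(** Put [J = j + 1], so that [J * b] is -1 modulo [modulus b j]. If [i] and [j] are [e + 1] apart,
    the two moduli differ by [(e + 1) * b], and multiplying by the [c] with [b = (e + 1) * c] turns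
    this into [b * b]. For [j < i] the factor [J * J] then gives the square of [J * b], which is 1.
    For [i < j] the difference has the opposite sign, and a further factor [b * J] gives minus the
    cube of [J * b], again 1. *)
Lemma modulus_invertible (n b i j : N) :
  (forall e, e < n -> exists c, b = (e + 1) * c) ->
  i <= n -> j <= n -> i <> j -> invertible (modulus b j) (modulus b i).
Proof.
  intros Hb Hi Hj Hij. destruct (trichotomy i j) as [H|[H|H]]; [|tauto|].
  - apply lt_ex in H as [e ->]. destruct (Hb e) as [c ->].
    { apply (lt_le_trans _ (i + e + 1)); auto. apply lt_ex. exists i. ring. }
    set (J := i + e + 1 + 1). set (b := (e + 1) * c).
    exists (c * b * (J * J * J)), 1, (b * c * (J * J) * (i + 1) + b * J).
    unfold modulus, b, J. ring.
  - apply lt_ex in H as [e ->]. destruct (Hb e) as [c ->].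
    { apply (lt_le_trans _ (j + e + 1)); auto. apply lt_ex. exists j. ring. }
    set (J := j + 1). set (b := (e + 1) * c).
    exists (c * (J * J)), 1, (c * (J * J) + b * J).
    unfold modulus, b, J. ring.
Qed.

(** Two instances are used: [b = 1], [c = 0] gives a common multiple of the numbers from 1 to [n],
    and [c = b] one of the moduli [modulus b e]. *)
Lemma common_multiple (b c n : N) : exists L, L <> 0 /\
  forall e, e < n -> exists q, L = (1 + e * b + c) * q.
Proof.
  revert n. apply Sg_ind; [sgdef| |].
  - exists 1. split.
    + intros E. apply (succ_ne_zero (0 : N)). rewrite add_0_l. exact E.
    + intros e He. destruct (nlt_0 _ He).
  - intros n (L & HL & H). exists ((1 + n * b + c) * L). split.
    + intros E. apply HL, (add_eq_0 _ (n * b * L + c * L)). rewrite <- E. ring.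
    + intros e He. apply lt_succ in He as [He| ->]; eauto.
      destruct (H e He) as [q ->]. exists ((1 + n * b + c) * q). ring.
Qed.

Hint Extern 1 (Def _ _) => apply Def_item : defn.

(** The Chinese remainder theorem for a partial function [G] with values up to [w]. The sequence is
    built one congruence at a time, without a code for it being available beforehand. *)
Lemma beta_lemma (G : N -> N -> Prop) (n w : N) :
  Bd (fun r => G (r 0%nat) (r 1%nat)) ->
  (forall i u v, G i u -> G i v -> u = v) ->
  (forall i v, G i v -> v <= w) ->
  exists s, forall i v, i <= n -> G i v -> item s i v.
Proof.
  intros HG Hu Hw.
  pose proof (fun t u => Def_subst2 bounded G t u HG) as HG'.
  destruct (common_multiple 1 0 n) as (L & HL & HLd).
  (* The factor [L] makes the moduli invertible modulo each other, and the factor [w + 1] makes them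
     exceed every value. *)
  set (b := L * (w + 1)).
  assert (Hb : forall e, e < n -> exists c, b = (e + 1) * c).
  { intros e He. destruct (HLd e He) as [q E]. exists (q * (w + 1)).
    unfold b. rewrite E. ring. }
  assert (Hbw : forall i, w < modulus b i).
  { intros i. assert (E : w + 1 <= b).
    { unfold b. rewrite (mul_comm L). apply le_mul_l, HL. }
    apply (lt_le_trans _ b); [order|]. apply le_ex.
    exists (1 + i * b). unfold modulus. ring. }
  clearbody b. clear L HL HLd.
  (* [a] solves the congruences below [k], while [P] is divisible by the moduli below [k] and
     invertible modulo the remaining ones. Bounding [v] by [w] keeps the formula Sigma^0_1. *)
  assert (A : forall k, n + 1 < k \/ exists a P,
    (forall i, i < k -> exists q, P = modulus b i * q) /\
    (forall j, j < n + 1 -> k <= j -> invertible (modulus b j) P) /\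
    (forall i, i < k -> forall v, v <= w -> G i v -> cong (modulus b i) a v)).
  { apply Sg_ind; [unfold invertible, cong, modulus; sgdef| |].
    - right. exists 0, 1. repeat split.
      + intros i Hi. destruct (nlt_0 _ Hi).
      + intros j _ _. exists 1. rewrite mul_1_l. apply cong_refl.
      + intros i Hi. destruct (nlt_0 _ Hi).
    - intros k [Hk|(a & P & HP & HI & HA)]; [left; order|].
      destruct (classic (k < n + 1)) as [Hk|Hk]; [right|left; order].
      destruct (HI k Hk) as [x Hx]; [order|].
      assert (S : exists a', cong P a' a /\
        forall v, G k v -> cong (modulus b k) a' v).
      { destruct (classic (exists v, G k v)) as [[v Gv]|no];
          [|exists a; split; [apply cong_refl|]; intros v Gv; destruct no; eauto].
        (* As [(k + 1) * b] is -1 modulo [modulus b k], the inner sum stands for [v - a].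
           Multiplying it by [P * x], which is 1 there, corrects [a] to [v] without disturbing the
           earlier congruences. *)
        exists (a + P * (x * (v + a * ((k + 1) * b)))). split; [apply cong_mult|].
        intros v' Gv'. rewrite <- (Hu k v v' Gv Gv'). clear v' Gv'.
        apply (cong_trans _ _ (a + 1 * (v + a * ((k + 1) * b)))).
        - apply cong_add; [apply cong_refl|]. rewrite mul_assoc.
          apply cong_mul; [exact Hx|apply cong_refl].
        - replace (a + 1 * (v + a * ((k + 1) * b))) with (v + modulus b k * a);
            [apply cong_mult|unfold modulus; ring]. }
      destruct S as (a' & Ha & Hk').
      exists a', (P * modulus b k). split; [|split].
      + intros i Hi. apply lt_succ in Hi as [Hi| ->].
        * destruct (HP i Hi) as [q ->]. exists (q * modulus b k). ring.
        * exists P. ring.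
      + intros j Hj Hkj. apply invertible_mul.
        * apply HI; auto. order.
        * apply (modulus_invertible n); auto; order.
      + intros i Hi v Hv Gv. apply lt_succ in Hi as [Hi| ->]; auto.
        apply (cong_trans _ _ a); auto. destruct (HP i Hi) as [q ->].
        destruct Ha as (u & u' & E). exists (q * u), (q * u').
        rewrite !mul_assoc. exact E. }
  destruct (A (n + 1)) as [C|(a & P & _ & _ & H)]; [destruct (lt_irrefl _ C)|].
  exists (pair a b). intros i v Hi Gv.
  assert (Hv : v < modulus b i) by (apply (le_lt_trans _ w); eauto).
  destruct (cong_lt _ _ _ (H i (proj2 (lt_succ i n) Hi) v (Hw _ _ Gv) Gv) Hv) as [q E].
  exists a, b, q. auto.
Qed.

Lemma append (s n v : N) : exists s',
  (forall i u, i < n -> item s i u -> item s' i u) /\ item s' n v.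
Proof.
  destruct (beta_lemma (fun i u => (i < n /\ item s i u) \/ (i = n /\ u = v)) n (s + v))
    as [s' H].
  - defn.
  - intros i u u' [[Hi Hu]|[-> ->]] [[Hi' Hu']|[Hi' ->]]; auto.
    + exact (item_unique _ _ _ _ Hu Hu').
    + order.
    + order.
  - intros i u [[Hi Hu]|[-> ->]]; [|apply le_add_r].
    apply (le_trans _ _ _ (item_le _ _ _ Hu)), le_add_l.
  - exists s'. split.
    + intros i u Hi Hu. apply H; [order|]. auto.
    + apply H; auto.
Qed.

End Coding.
#[export] Hint Extern 1 (Def _ _) => apply Def_item : defn.

(** * Bounded Sigma^0_1 comprehension and a pigeonhole principle *)

Section Comprehension.
Context {M : structure} {HM : RCA0 M}.
Notation N := (num M).
Notation env := (nat -> num M).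
Notation Bd := (Def bounded).
Add Ring num_ring : (num_semi_ring (M := M)).

(** The set is coded by the least nonzero common multiple [z] of the moduli of those [t <= n] with
    [P t]. Being such a multiple is Pi^0_1, so [least_Pi] provides [z], and a bounded divisibility
    test recovers the elements. *)
Lemma bounded_Sg_comprehension (P : N -> Prop) n : Sg (fun r => P (r O)) ->
  exists X : sets M, forall t, t ∈ X <-> t <= n /\ P t.
Proof.
  intros HP.
  destruct (common_multiple 1 0 n) as (b & Hb0 & Hb).
  assert (Hb' : forall e, e < n -> exists c, b = (e + 1) * c).
  { intros e He. destruct (Hb e He) as [q E]. exists q. rewrite E at 1. ring. }
  clear Hb. destruct (common_multiple b b (n + 1)) as (L & HL0 & HL).
  set (divides := fun z t => exists q, q <= z /\ z = modulus b t * q).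
  assert (Hdiv : forall z t q, z = modulus b t * q -> divides z t).
  { intros z t q E. exists q. split; auto. rewrite E, mul_comm. apply le_mul_l.
    pose proof (modulus_pos b t). intros E'. order. }
  destruct (least_Pi (fun z => z <> 0 /\ forall t, t <= n -> P t -> divides z t) L)
    as (z & (Hz0 & Hz) & Hmin).
  - apply (Sg_iff (fun r => r O = 0 \/
      exists t, t <= n /\ P t /\ ~ divides (r O) t)).
    + intros r. split.
      * intros [E|(t & Ht & Pt & nd)] [H0 H1]; auto.
      * intros H. apply NNPP. intros C. apply H. split; [tauto|].
        intros t Ht Pt. apply NNPP. intros nd. apply C. right. eauto.
    + unfold divides, modulus. sgdef.
  - split; auto. intros t Ht _. destruct (HL t) as [q E]; [order|].
    apply (Hdiv L t q). rewrite E at 1. unfold modulus. ring.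
  - destruct (Bd_comprehension (fun t => t <= n /\ divides z t)) as [X HX].
    { unfold divides, modulus. defn. }
    exists X. intros t. rewrite HX. split; intros [Ht H]; split; auto.
    (* If [P t] failed, [z] divided by the modulus of [t] would still be a
       common multiple, since the moduli are pairwise coprime. *)
    apply NNPP. intros nP. destruct H as (q & _ & E).
    assert (Hq0 : q <> 0).
    { intros ->. apply Hz0. rewrite E. apply mul_0_r. }
    apply (Hmin q).
    (* The modulus exceeds 1 because [b] is not zero, so the quotient [q] is smaller than [z]. *)
    + destruct (zero_or_succ b) as [->|[b' ->]]; [tauto|].
      destruct (zero_or_succ q) as [->|[q' ->]]; [tauto|].
      rewrite E. apply lt_ex. exists (q' + t * (b' + 1) * (q' + 1) + b' * (q' + 1)).
      unfold modulus. ring.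
    + split; auto. intros t' Ht' Pt'.
      destruct (Hz t' Ht' Pt') as (q' & _ & E').
      destruct (invertible_divides (modulus b t') (modulus b t) q) as [k Hk].
      * apply (modulus_invertible n); auto. congruence.
      * apply modulus_pos.
      * exists q'. congruence.
      * exact (Hdiv q t' k Hk).
Qed.

(** If all values were at most [b], the set of values would exist by bounded comprehension, and
    collection would bound by some [c] a choice of preimages for all of them. The index [c] itself
    has a value, whose only preimage would then lie below [c]. *)
Lemma injection_unbounded (H : N -> N -> Prop) b :
  (forall t u, Tm t -> Tm u -> Sg (fun r => H (t r) (u r))) ->
  (forall i, exists n, H i n) ->
  (forall i j n, H i n -> H j n -> i = j) ->
  exists i n, H i n /\ b < n.
Proof.
  intros HH tot inj. apply NNPP. intros no.
  assert (Hb : forall i n, H i n -> n <= b).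
  { intros i n Hn. apply NNPP. intros C. apply no. exists i, n.
    split; auto. order. }
  destruct (bounded_Sg_comprehension (fun n => exists i, H i n) b) as [X HX];
    [sgdef|].
  (* The implication makes the relation total: a number that is not a value gets the default
     preimage 0. *)
  destruct (collection (fun n i => n ∈ X -> H i n) (b + 1)) as [c Hc].
  - sgdef.
  - intros n Hn. destruct (classic (n ∈ X)) as [Xn|Xn].
    + apply HX in Xn as [_ [i Hi]]. eauto.
    + exists 0. tauto.
  - destruct (tot c) as [n Hn].
    destruct (Hc n) as (i & Hi & Hi'); [apply lt_succ; eauto|].
    rewrite (inj i c n) in Hi; auto.
    + destruct (lt_irrefl _ Hi).
    + apply Hi', HX. eauto.
Qed.

(** * From Sigma^0_1 comprehension to arithmetical comprehension *)

Definition sigma01_comprehension : Prop :=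
  forall P : N -> Prop, Sg (fun r => P (r O)) ->
  exists X : sets M, forall a, a ∈ X <-> P a.

Lemma Sg_reindex (P : env -> Prop) f :
  injective f -> Sg P -> Sg (fun r => P (fun i => r (f i))).
Proof.
  intros Hf (Q & HQ & E). exists (fun r x => Q (fun i => r (f i)) x). split.
  - apply (Def_reindex _ (fun n => match n with O => O | S i => S (f i) end)) in HQ.
    + exact HQ.
    + intros [|i] [|j]; try lia. intros H. f_equal. apply Hf. lia.
  - intros r. apply E.
Qed.

(** Comprehension has one number variable, so a predicate of [K] variables is first reduced to one
    variable by repeatedly coding the first two as a pair. Membership in the resulting set is then
    Sigma^0_0. The number [K] is standard, bounding the variables of a formula. *)
Lemma Sg_Bd (AC : sigma01_comprehension) K : forall P : env -> Prop, Sg P ->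
  (forall r r', (forall i, (i < K)%nat -> r i = r' i) -> P r <-> P r') -> Bd P.
Proof.
  induction K as [|[|K] IH]; intros P HP Hfin.
  - destruct (classic (P (fun _ => 0))) as [H|H].
    + apply (Def_iff (fun r => (0 : N) = 0)); [|defn].
      intros r. rewrite (Hfin r (fun _ => 0)); [tauto|lia].
    + apply (Def_iff (fun r => (0 : N) <> 0)); [|defn].
      intros r. rewrite (Hfin r (fun _ => 0)); [tauto|lia].
  - destruct (AC (fun a => P (scons a (fun _ => 0)))) as [X HX].
    + apply (Sg_iff P); auto. intros r. apply Hfin. intros [|i]; [reflexivity|lia].
    + apply (Def_iff (fun r => r O ∈ X)); [|defn].
      intros r. rewrite HX. apply Hfin. intros [|i]; [reflexivity|lia].
  - set (P' := fun r : env => exists y x, r O = pair x y /\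
      P (scons x (scons y (tail r)))).
    assert (HP' : Bd P').
    { apply IH.
      - apply Sg_ex, Sg_ex, Sg_and; [apply Bd_Sg; defn|].
        apply (Sg_reindex P drop2) in HP; [|apply drop2_inj].
        revert HP. apply Sg_iff. intros r.
        match goal with |- P ?a <-> P ?b => replace b with a; [tauto|] end.
        apply functional_extensionality; intros [|[|i]]; reflexivity.
      - intros r r' H. unfold P'. rewrite (H O) by lia.
        assert (E : forall x y, P (scons x (scons y (tail r))) <->
          P (scons x (scons y (tail r')))).
        { intros x y. apply Hfin. intros [|[|i]] Hi; try reflexivity.
          apply H. lia. }
        split; intros (y & x & Ex & Hx); exists y, x; split; auto; apply E; auto. }
    (* A variable cannot be renamed to a pair, so the pair is named by the bounded variable [z]. *)
    apply (Def_iff (fun r => exists z, z < pair (r 0%nat) (r 1%nat) + 1 /\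
      (z = pair (r 0%nat) (r 1%nat) /\ P' (scons z (tail (tail r)))))).
    + assert (E : forall r : env, P' (scons (pair (r 0%nat) (r 1%nat)) (tail (tail r))) <-> P r).
      { intros r. unfold P'. split.
        - intros (y & x & E & H). simpl in E. apply pair_inj in E as [<- <-].
          apply (Hfin _ r) in H; auto. intros [|[|i]] _; reflexivity.
        - intros H. exists (r 1%nat), (r 0%nat). split; [reflexivity|].
          apply (Hfin _ r); auto. intros [|[|i]] _; reflexivity. }
      intros r. split.
      * intros (z & _ & -> & H). apply E, H.
      * intros H. exists (pair (r 0%nat) (r 1%nat)).
        do 2 (split; auto using lt_succ_diag). apply E, H.
    + apply Def_bex; [tm|]. apply Def_and; [defn|].
      apply (Def_reindex P' (fun n => match n with O => O | S i => S (S (S i)) end)) in HP'.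
      * revert HP'. apply Def_iff. intros r.
        match goal with |- P' ?a <-> P' ?b => replace b with a; [tauto|] end.
        apply functional_extensionality; intros [|i]; reflexivity.
      * intros [|i] [|j]; lia.
Qed.

Lemma update_agree {A : Type} K (r r' : nat -> A) n a :
  (forall i, (i < K)%nat -> r i = r' i) ->
  forall i, (i < K)%nat -> update r n a i = update r' n a i.
Proof.
  intros H i Hi. unfold update. destruct (Nat.eqb i n); auto.
Qed.

Lemma eval_finite t : exists K, forall r r' : env,
  (forall i, (i < K)%nat -> r i = r' i) -> eval r t = eval r' t.
Proof.
  induction t as [n| | |t [K HK] u [L HL]|t [K HK] u [L HL]]; simpl.
  - exists (S n). auto.
  - exists O. auto.
  - exists O. auto.
  - exists (max K L). intros r r' H. rewrite (HK r r'), (HL r r'); auto;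
      intros i Hi; apply H; lia.
  - exists (max K L). intros r r' H. rewrite (HK r r'), (HL r r'); auto;
      intros i Hi; apply H; lia.
Qed.

Lemma sat_finite (s : nat -> sets M) p : arithmetical p -> exists K, forall r r' : env,
  (forall i, (i < K)%nat -> r i = r' i) -> sat r s p <-> sat r' s p.
Proof.
  induction p; simpl; intros Hp; try tauto.
  - destruct (eval_finite t) as [K HK], (eval_finite u) as [L HL].
    exists (max K L). intros r r' H. rewrite (HK r r'), (HL r r'); [tauto| |];
      intros i Hi; apply H; lia.
  - destruct (eval_finite t) as [K HK], (eval_finite u) as [L HL].
    exists (max K L). intros r r' H. rewrite (HK r r'), (HL r r'); [tauto| |];
      intros i Hi; apply H; lia.
  - destruct (eval_finite t) as [K HK]. exists K. intros r r' H.
    rewrite (HK r r' H). tauto.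
  - destruct (IHp Hp) as [K HK]. exists K. intros r r' H. rewrite (HK r r' H). tauto.
  - destruct (IHp1 (proj1 Hp)) as [K HK], (IHp2 (proj2 Hp)) as [L HL].
    exists (max K L). intros r r' H. rewrite (HK r r'), (HL r r'); [tauto| |];
      intros i Hi; apply H; lia.
  - destruct (IHp1 (proj1 Hp)) as [K HK], (IHp2 (proj2 Hp)) as [L HL].
    exists (max K L). intros r r' H. rewrite (HK r r'), (HL r r'); [tauto| |];
      intros i Hi; apply H; lia.
  - destruct (IHp1 (proj1 Hp)) as [K HK], (IHp2 (proj2 Hp)) as [L HL].
    exists (max K L). intros r r' H. rewrite (HK r r'), (HL r r'); [tauto| |];
      intros i Hi; apply H; lia.
  - destruct (IHp Hp) as [K HK]. exists K. intros r r' H.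
    split; intros Ha a; apply (HK _ _ (update_agree K _ _ n a H)), Ha.
  - destruct (IHp Hp) as [K HK]. exists K. intros r r' H.
    split; intros [a Ha]; exists a; apply (HK _ _ (update_agree K _ _ n a H)), Ha.
Qed.

Lemma Tm_eval t : Tm (fun r : env => eval r t).
Proof.
  induction t; simpl; auto using Tm_var, Tm_const, Tm_add, Tm_mul.
Qed.

Lemma Bd_update_var (P : env -> Prop) n : Bd P ->
  Bd (fun r => P (update (tail r) n (r O))).
Proof.
  intros HP.
  apply (Def_reindex P (fun i => if Nat.eqb i n then O else S i)) in HP.
  - revert HP. apply Def_iff. intros r.
    match goal with |- P ?a <-> P ?b => replace b with a; [tauto|] end.
    apply functional_extensionality; intros i. unfold update.
    destruct (Nat.eqb i n); reflexivity.
  - intros i j. destruct (Nat.eqb_spec i n), (Nat.eqb_spec j n); lia.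
Qed.

(** Under Sigma^0_1 comprehension, quantifiers can be traded for set
    parameters. *)
Lemma arithmetical_Bd (AC : sigma01_comprehension) (s : nat -> sets M) p :
  arithmetical p -> Bd (fun r => sat r s p).
Proof.
  assert (E : forall p n, arithmetical p -> Bd (fun r => sat r s p) ->
    Bd (fun r => exists a, sat (update r n a) s p)).
  { clear p. intros p n Ap Hp. destruct (sat_finite s p Ap) as [K HK].
    apply (Sg_Bd AC K).
    - apply Sg_ex, Bd_Sg, (Bd_update_var (fun r => sat r s p)), Hp.
    - intros r r' H.
      split; intros [a Ha]; exists a; apply (HK _ _ (update_agree K _ _ n a H)), Ha. }
  induction p; simpl; intros Hp; try tauto.
  - apply Def_eq; apply Tm_eval.
  - apply Def_lt; apply Tm_eval.
  - apply Def_mem, Tm_eval.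
  - apply Def_not; auto.
  - apply Def_and; tauto.
  - apply Def_or; tauto.
  - apply Def_imp; tauto.
  - apply (Def_iff (fun r => ~ exists a, sat (update r n a) s (f_not p))).
    + intros r. split.
      * intros H a. apply NNPP. intros C. apply H. exists a. exact C.
      * intros H [a Ha]. exact (Ha (H a)).
    + apply Def_not, E; [exact Hp|]. apply Def_not; auto.
  - apply E; auto.
Qed.

(** Where [f] is [None], the value from [e] is added to the parameters. This reduces a formula in an
    arbitrary environment to a predicate of the variables that remain. *)
Lemma Def_instantiate K {HK : formula_class K} (P : env -> Prop) (e : env)
    (f : nat -> option nat) :
  (forall i j k, f i = Some k -> f j = Some k -> i = j) -> Def K P ->
  Def K (fun r => P (fun i => match f i with Some j => r j | None => e i end)).
Proof.
  intros Hf (p & c & s & Kp & Hp).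
  set (q := fun n => if Nat.even n
    then match f (Nat.div2 n) with Some j => 2 * j | None => 4 * Nat.div2 n + 1 end%nat
    else (4 * Nat.div2 n + 3)%nat).
  assert (Hq : injective q).
  { intros i j. unfold q.
    destruct (even_odd_cases i) as [i' [->| ->]];
    destruct (even_odd_cases j) as [j' [->| ->]];
    rewrite ?Nat.even_even, ?Nat.even_odd, ?Nat.div2_double, ?div2_odd_eq.
    - destruct (f i') eqn:Ei, (f j') eqn:Ej; try lia.
      intros E. rewrite (Hf i' j' n); auto. rewrite Ej. f_equal. lia.
    - destruct (f i'); lia.
    - destruct (f j'); lia.
    - lia. }
  exists (fren q (fun i => i) p), (merge e c), s.
  split; [apply class_fren; auto|]. intros r.
  rewrite sat_fren by (auto; apply class_arithmetical; auto).
  rewrite <- (Hp (fun i => match f i with Some j => r j | None => e i end)).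
  match goal with |- sat ?a _ _ <-> sat ?b _ _ => replace b with a; [tauto|] end.
  apply functional_extensionality; intros n. unfold q.
  destruct (even_odd_cases n) as [i [->| ->]];
    rewrite ?Nat.even_even, ?Nat.even_odd, ?Nat.div2_double, ?div2_odd_eq.
  - rewrite merge_even. destruct (f i); [apply merge_even|].
    replace (4 * i + 1)%nat with (2 * (2 * i) + 1)%nat by lia.
    rewrite merge_odd, merge_even. reflexivity.
  - replace (4 * i + 3)%nat with (2 * (2 * i + 1) + 1)%nat by lia.
    rewrite !merge_odd. reflexivity.
Qed.

Lemma sigma01_arithmetical_comprehension :
  sigma01_comprehension -> arithmetical_comprehension M.
Proof.
  intros AC p Ap e s x.
  apply (Bd_comprehension (fun a => sat (update e x a) s p)).
  apply (Def_iff (fun r => sat (fun i => match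
    (if Nat.eqb i x then Some O else None) with Some j => r j | None => e i end) s p)).
  - intros r.
    match goal with |- sat ?a _ _ <-> sat ?b _ _ => replace b with a; [tauto|] end.
    apply functional_extensionality; intros i. unfold update.
    destruct (Nat.eqb i x); reflexivity.
  - apply (Def_instantiate bounded (fun r => sat r s p)).
    + intros i j k. destruct (Nat.eqb_spec i x), (Nat.eqb_spec j x); congruence.
    + apply arithmetical_Bd; auto.
Qed.

End Comprehension.

(** * Coded paths and components *)

Section Paths.
Context {M : structure} {HM : RCA0 M}.
Notation N := (num M).
Notation env := (nat -> num M).
Notation Bd := (Def bounded).
Add Ring num_ring : (num_semi_ring (M := M)).

Lemma Def_adjacent K {HK : formula_class K} (E : sets M) (t u : env -> N) :
  Tm t -> Tm u -> Def K (fun r => adjacent E (t r) (u r)).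
Proof. intros. unfold adjacent. defn. Qed.
Hint Extern 1 (Def _ _) => apply Def_adjacent : defn.

Lemma joined_refl (E : sets M) (x : N) : joined E x x.
Proof.
  destruct (append 0 0 x) as (s & _ & Hs). exists s, 0. split; [|split]; auto.
  intros i Hi. destruct (nlt_0 _ Hi).
Qed.

Lemma joined_step (E : sets M) (x y z : N) :
  joined E x y -> adjacent E y z -> joined E x z.
Proof.
  intros (s & n & H0 & Hp & Hn) Hyz.
  destruct (append s (n + 1) z) as (s' & Hs & Hz).
  exists s', (n + 1). split; [|split; auto].
  - apply Hs; auto. apply lt_ex. exists n. ring.
  - intros i Hi. apply lt_succ in Hi as [Hi| ->].
    + destruct (Hp i Hi) as (u & v & Hu & Hv & Huv). exists u, v.
      split; [|split; auto]; apply Hs; auto; [order|apply succ_lt_mono, Hi].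
    + exists y, z. split; [|split]; auto. apply Hs; auto. order.
Qed.

Lemma joined_closed (E C : sets M) (x y : N) :
  (forall u v, adjacent E u v -> u ∈ C -> v ∈ C) ->
  joined E x y -> x ∈ C -> y ∈ C.
Proof.
  intros HC (s & n & H0 & Hp & Hn) Hx.
  assert (A : forall i, n < i \/ exists u, item s i u /\ u ∈ C).
  { apply Sg_ind; [sgdef|right; eauto|].
    intros i [Hi|(u & Hu & Cu)]; [left; order|].
    destruct (classic (i < n)) as [Hi|Hi]; [right|left; order].
    destruct (Hp i Hi) as (u' & v & Hu' & Hv & Huv).
    rewrite (item_unique _ _ _ _ Hu' Hu) in Huv. eauto. }
  destruct (A n) as [C'|(u & Hu & Cu)]; [destruct (lt_irrefl _ C')|].
  rewrite (item_unique _ _ _ _ Hn Hu). exact Cu.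
Qed.

Lemma component_same_set (V E C C' : sets M) x :
  component V E C -> component V E C' -> x ∈ C -> x ∈ C' -> same_set C C'.
Proof.
  intros (_ & _ & J & K) (_ & _ & J' & K') Hx Hx' y. split; intros Hy.
  - apply (K' x); auto.
  - apply (K x); auto.
Qed.

End Paths.
#[export] Hint Extern 1 (Def _ _) => apply Def_adjacent : defn.

(** * The graph of an injection *)

Section Injection.
Context {M : structure} {HM : RCA0 M}.
Notation N := (num M).
Notation env := (nat -> num M).
Notation Bd := (Def bounded).
Add Ring num_ring : (num_semi_ring (M := M)).

Context (G : N -> N -> Prop).
Context (G_Bd : Bd (fun r => G (r 0%nat) (r 1%nat))).
Context (G_total : forall n, exists v, G n v).
Context (G_unique : forall n u v, G n u -> G n v -> u = v).
Context (G_inj : forall n m v, G n v -> G m v -> n = m).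
Context (G_le : forall n v, G n v -> v <= n + n + 1).

Let Bd_G t u : Tm t -> Tm u -> Bd (fun r => G (t r) (u r)).
Proof. exact (Def_subst2 bounded G t u G_Bd). Qed.
Hint Extern 1 (Def _ _) => apply Bd_G : defn.

(** Compares the values at [m] and [k]. The bounds come from [G_le] and make the comparison
    Sigma^0_0. *)
Definition below (m k : N) : Prop :=
  exists u, u <= m + m + 1 /\ exists v, v <= k + k + 1 /\ (G m u /\ G k v /\ u < v).

Lemma below_values m k u v : G m u -> G k v -> (below m k <-> u < v).
Proof.
  intros Hu Hv. split.
  - intros (u' & _ & v' & _ & Hu' & Hv' & H).
    rewrite (G_unique _ _ _ Hu Hu'), (G_unique _ _ _ Hv Hv'). exact H.
  - intros H. exists u. split; auto. exists v. split; auto.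
Qed.

Lemma below_asym m k : below m k -> ~ below k m.
Proof.
  destruct (G_total m) as [u Hu], (G_total k) as [v Hv].
  rewrite (below_values m k u v), (below_values k m v u) by auto. order.
Qed.

Lemma Bd_below t u : Tm t -> Tm u ->
  Bd (fun r => below (t r) (u r)).
Proof. intros. unfold below. defn. Qed.
Hint Extern 1 (Def _ _) => apply Bd_below : defn.

(** [t] is the place of the minimum of [G] on [[n, oo)]. *)
Definition root (n t : N) : Prop :=
  n <= t /\ forall k, n <= k -> k <> t -> below t k.

Lemma root_exists n : exists t, root n t.
Proof.
  destruct (G_total n) as [v0 Hv0].
  destruct (least_Sg (fun v => exists k, n <= k /\ G k v) v0) as (v & (t & Ht & Hv) & Hmin).
  - sgdef.
  - exists n. auto.
  - exists t. split; auto. intros k Hk Hkt.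
    destruct (G_total k) as [u Hu]. apply (below_values _ _ v u); auto.
    assert (u <> v) by (intros ->; apply Hkt; eauto).
    assert (~ u < v) by (intros C; exact (Hmin u C (ex_intro _ k (conj Hk Hu)))).
    order.
Qed.

Lemma root_unique n t t' : root n t -> root n t' -> t = t'.
Proof.
  intros [H1 H2] [H1' H2']. apply NNPP. intros C.
  apply (below_asym t t'); auto.
Qed.

Lemma root_mono n m t : root n t -> n <= m -> m <= t -> root m t.
Proof.
  intros [H1 H2] Hm Ht. split; auto. intros k Hk. apply H2. order.
Qed.

Definition edge (n m : N) : Prop :=
  n < m /\ forall k, k < m -> n <= k -> below m k.

(** If [m] lay beyond the root [t] of [n], then [t] would be in [[n, m)] and the edge would put the
    value at [m] below the minimum. *)
Lemma edge_root n m t : edge n m -> root n t -> root m t.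
Proof.
  intros [Hnm He] Ht. apply (root_mono n); auto.
  apply NNPP. intros C. destruct Ht as [Hnt Ht].
  apply (below_asym m t).
  - apply He; order.
  - apply Ht; order.
Qed.

Lemma edge_root_inv n m t : edge n m -> root m t -> root n t.
Proof.
  intros He Hm. destruct (root_exists n) as [t' Ht'].
  rewrite (root_unique m t t'); auto. apply (edge_root n); auto.
Qed.

Lemma root_edge n t : root n t -> n = t \/ edge n t.
Proof.
  intros [Hn Ht]. destruct (classic (n = t)); auto. right. split; [order|].
  intros k Hk Hnk. apply Ht; order.
Qed.

Lemma injection_graph : exists V E : sets M,
  (forall x, x ∈ V) /\ (forall x y, adjacent E x y <-> edge x y \/ edge y x) /\
  graph V E.
Proof.
  destruct (Bd_comprehension (fun x : N => x = x)) as [V HV]; [defn|].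
  destruct (Bd_comprehension (fun e => exists n, n <= e /\ exists m, m <= e /\
    (e = pair n m /\ edge n m))) as [E HE]; [unfold edge; defn|].
  assert (HV' : forall x, x ∈ V) by (intros x; apply HV; reflexivity).
  assert (HE' : forall n m, pair n m ∈ E <-> edge n m).
  { intros n m. rewrite HE. split.
    - intros (n' & _ & m' & _ & Eq & H). apply pair_inj in Eq as [-> ->]. exact H.
    - intros H. exists n. split; [apply le_pair_l|]. exists m.
      split; [apply le_pair_r|]. auto. }
  exists V, E. split; [|split]; auto.
  - intros x y. unfold adjacent. rewrite !HE'. unfold edge. tauto.
  - split.
    + intros [b Hb]. exact (lt_irrefl b (Hb b (HV' b))).
    + intros e He. apply HE in He as (n & _ & m & _ & Eq & H).
      exists n, m. repeat split; auto. apply H.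
Qed.

Section Graph.
Context (V E : sets M) (HV : forall x, x ∈ V)
  (HE : forall x y, adjacent E x y <-> edge x y \/ edge y x).

(** As such [root y t] is Pi^0_1, but given [root t t] only the [k < t] remain to be checked. So the
    class of vertices with root [t] is a set in RCA_0; it is connected through [t] and closed under
    edges in both directions. *)
Lemma root_component t : root t t ->
  exists C, component V E C /\ forall y, y ∈ C <-> root y t.
Proof.
  intros Ht.
  destruct (Bd_comprehension (fun y => y <= t /\
    forall k, k < t -> y <= k -> below t k)) as [C HC]; [defn|].
  assert (HC' : forall y, y ∈ C <-> root y t).
  { intros y. rewrite HC. split.
    - intros [Hy H]. split; auto. intros k Hk Hkt.
      destruct (trichotomy k t) as [L|[L|L]]; auto; [tauto|].
      apply Ht; order.
    - intros [Hy H]. split; auto. intros k Hk Hyk. apply H; order. }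
  exists C. split; auto. split; [|split; [|split]]; auto.
  - exists t. apply HC', Ht.
  - intros x y Hx Hy. apply HC' in Hx, Hy.
    assert (J : joined E x t).
    { destruct (root_edge x t Hx) as [->|e]; [apply joined_refl|].
      apply (joined_step _ _ x); [apply joined_refl|]. apply HE; auto. }
    destruct (root_edge y t Hy) as [->|e]; auto.
    apply (joined_step _ _ t); auto. apply HE; auto.
  - intros x y Hx Hxy. apply (joined_closed E C x y); auto.
    intros u v Huv Hu. apply HC'. apply HC' in Hu. apply HE in Huv as [e|e].
    + exact (edge_root u v t e Hu).
    + exact (edge_root_inv v u t e Hu).
Qed.

Lemma root_root n t : root n t -> root t t.
Proof.
  intros H. apply (root_mono n); auto. apply H.
Qed.

Lemma injection_finite_components : finite_components V E.
Proof.
  intros x _. destruct (root_exists x) as [t Ht].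
  destruct (root_component t (root_root _ _ Ht)) as (C & HC & HCt).
  exists C. split; [|split]; auto.
  - apply HCt, Ht.
  - exists (t + 1). intros y Hy. apply HCt in Hy as [Hy _]. order.
Qed.

Definition connected (n m : N) : Prop :=
  exists C, component V E C /\ n ∈ C /\ m ∈ C.

Lemma connected_refl n : connected n n.
Proof.
  destruct (injection_finite_components n (HV n)) as (C & HC & Hn & _).
  exists C. auto.
Qed.

Lemma disconnected_root n m t : n < m -> ~ connected n m -> root n t -> t < m.
Proof.
  intros Hnm H Ht. apply NNPP. intros C. apply H.
  destruct (root_component t (root_root _ _ Ht)) as (D & HD & HDt).
  exists D. rewrite !HDt. split; [|split]; auto. apply (root_mono n); auto; order.
Qed.

(** If [n < m] are disconnected, then [G] attains its minimum on [[n, oo)]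
    already on [[n, m]]; so such pairs bound the search for preimages. *)
Lemma range_comprehension_pairs (T : N -> N -> Prop) :
  (forall t u, Tm t -> Tm u -> Sg (fun r => T (t r) (u r))) ->
  (forall n m, T n m -> n < m /\ ~ connected n m) ->
  (forall b, exists n m, b < n /\ T n m) ->
  exists X : sets M, forall v, v ∈ X <-> exists n, G n v.
Proof.
  intros HT T1 T2.
  set (bounds := fun n m v => forall k, k <= m -> n <= k ->
    forall u, u <= k + k + 1 -> G k u -> v < u).
  assert (Hb : forall n m v, T n m -> bounds n m v ->
    forall k u, n <= k -> G k u -> v < u).
  { intros n m v Tnm H k u Hk Hu. destruct (T1 n m Tnm) as [Hnm Hd].
    destruct (root_exists n) as [t Ht].
    pose proof (disconnected_root n m t Hnm Hd Ht) as Htm.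
    destruct (G_total t) as [w Hw].
    assert (Hvw : v < w).
    { apply (H t); auto. apply Ht. }
    destruct (classic (k = t)) as [->|Hkt].
    - rewrite (G_unique _ _ _ Hu Hw). exact Hvw.
    - apply Ht in Hkt; auto. apply (below_values _ _ w u) in Hkt; auto. order. }
  assert (Hex : forall v, exists n m, T n m /\ bounds n m v).
  (* Induction on [v]: a pair starting beyond [m] lies beyond the root [t] of [n], so its values
     exceed the value at [t], which is at least [v] already. *)
  { assert (A : forall v, exists n m, T n m /\ forall k, k <= m -> n <= k ->
      forall u, u <= k + k + 1 -> G k u -> v <= u).
    { apply Sg_ind; [sgdef| |].
      - destruct (T2 0) as (n & m & _ & H). exists n, m. split; auto.
        intros. apply le_0.
      - intros v (n & m & Tnm & H). destruct (T1 n m Tnm) as [Hnm Hd].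
        destruct (T2 m) as (n' & m' & Hn' & Tnm'). exists n', m'. split; auto.
        intros k Hk Hnk u _ Hu. destruct (root_exists n) as [t Ht].
        pose proof (disconnected_root n m t Hnm Hd Ht) as Htm.
        destruct (G_total t) as [w Hw].
        assert (Hvw : v <= w).
        { apply (H t); auto. apply Ht. }
        assert (Hwu : w < u).
        { apply (below_values t k); auto. apply Ht; order. }
        order. }
    intros v. destruct (A (v + 1)) as (n & m & Tnm & H). exists n, m. split; auto.
    intros k Hk Hnk u Hu Hku. pose proof (H k Hk Hnk u Hu Hku). order. }
  apply Sg_comprehension; [sgdef|].
  (* A Sigma^0_1 form of the complement: once [v] is below all values from [n] on, only the places
     before [n] need to be searched. *)
  apply (Sg_iff (fun r => exists n m, T n m /\ bounds n m (r O) /\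
    forall k, k < n -> ~ G k (r O))).
  - intros r. split.
    + intros (n & m & Tnm & H & Hk) [k Hu].
      destruct (classic (k < n)) as [L|L]; [exact (Hk k L Hu)|].
      apply (lt_irrefl (r O)), (Hb n m (r O) Tnm H k); auto. order.
    + intros H. destruct (Hex (r O)) as (n & m & Tnm & Hnm).
      exists n, m. repeat split; auto. intros k _ Hk. apply H. eauto.
  - unfold bounds. sgdef.
Qed.

(** Every vertex is connected to itself, so vertices at different indices differ. By pigeonhole the
    sequence is unbounded, and two successive choices give pairs beyond any given number. *)
Lemma range_comprehension_sequence (H : N -> N -> Prop) :
  (forall t u, Tm t -> Tm u -> Sg (fun r => H (t r) (u r))) ->
  (forall i, exists n, H i n) ->
  (forall i n m, H i n -> H i m -> n = m) ->
  (forall i j n m, i <> j -> H i n -> H j m -> ~ connected n m) ->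
  exists X : sets M, forall v, v ∈ X <-> exists n, G n v.
Proof.
  intros HH Htot Hfun Hd.
  assert (inj : forall i j n, H i n -> H j n -> i = j).
  { intros i j n Hi Hj. apply NNPP. intros C.
    exact (Hd i j n n C Hi Hj (connected_refl n)). }
  apply (range_comprehension_pairs (fun n m => n < m /\
    exists i j, i <> j /\ H i n /\ H j m)).
  - intros t u Ht Hu. sgdef.
  - intros n m (Hnm & i & j & Hij & Hi & Hj). split; auto. exact (Hd i j n m Hij Hi Hj).
  - intros b. destruct (injection_unbounded H b HH Htot inj) as (i & n & Hi & Hn).
    destruct (injection_unbounded H n HH Htot inj) as (j & m & Hj & Hm).
    exists n, m. split; auto. split; auto. exists i, j. split; auto.
    intros <-. rewrite (Hfun i n m Hi Hj) in Hm. exact (lt_irrefl _ Hm).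
Qed.

End Graph.
End Injection.

(** * From ranges of injections to the reversals *)

Section Reversal.
Context {M : structure} {HM : RCA0 M}.
Notation N := (num M).
Notation env := (nat -> num M).
Notation Bd := (Def bounded).
Add Ring num_ring : (num_semi_ring (M := M)).

Lemma mul_cancel_l (z a b : N) : z <> 0 -> z * a = z * b -> a = b.
Proof.
  assert (L : forall a b, z <> 0 -> a < b -> z * a <> z * b).
  { clear a b. intros a b Hz H E. apply lt_ex in H as [d ->].
    destruct (zero_or_succ z) as [->|[w ->]]; [tauto|].
    apply (succ_ne_zero (w * d + d + w)). apply (add_cancel_l _ _ ((w + 1) * a)).
    rewrite add_0_r. etransitivity; [|symmetry; exact E]. ring. }
  intros Hz E. destruct (trichotomy a b) as [H|[H|H]]; auto.
  - destruct (L a b Hz H E).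
  - destruct (L b a Hz H (eq_sym E)).
Qed.

Lemma parity (n : N) : exists k, n = k + k \/ n = k + k + 1.
Proof.
  revert n. apply Sg_ind; [sgdef| |].
  - exists 0. left. ring.
  - intros n [k [->| ->]]; [exists k; auto|]. exists (k + 1). left. ring.
Qed.

Lemma double_ne_odd (m n : N) : m + m <> n + n + 1.
Proof.
  intros E. destruct (trichotomy m n) as [H|[->|H]].
  - apply lt_ex in H as [d ->]. apply (succ_ne_zero (d + d + 1 + 1)).
    apply (add_cancel_l _ _ (m + m)). rewrite add_0_r.
    etransitivity; [|symmetry; exact E]. ring.
  - apply (succ_ne_zero (0 : N)). rewrite add_0_l.
    apply (add_cancel_l _ _ (n + n)). rewrite add_0_r. auto.
  - apply lt_ex in H as [d ->]. apply (succ_ne_zero (d + d)).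
    apply (add_cancel_l _ _ (n + n + 1)). rewrite add_0_r.
    etransitivity; [|exact E]. ring.
Qed.

Lemma double_inj (m n : N) : m + m = n + n -> m = n.
Proof.
  intros E. apply (mul_cancel_l (1 + 1)); [apply succ_ne_zero|].
  etransitivity; [|etransitivity; [exact E|]]; ring.
Qed.

(** A stage that finds the first witness of [x] gets the value [2x]; an idle stage [n] gets
    [2n + 1], which keeps [G] total and injective. Thus [x] satisfies [P] exactly when [2x] is in
    the range. The stage [pair x y] is at least [x], whence the bound [n + n + 1]. *)
Lemma sigma01_comprehension_ranges :
  (forall G : N -> N -> Prop,
    Bd (fun r => G (r 0%nat) (r 1%nat)) ->
    (forall n, exists v, G n v) ->
    (forall n u v, G n u -> G n v -> u = v) ->
    (forall n m v, G n v -> G m v -> n = m) ->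
    (forall n v, G n v -> v <= n + n + 1) ->
    exists X : sets M, forall v, v ∈ X <-> exists n, G n v) ->
  sigma01_comprehension (M := M).
Proof.
  intros HR P (Q & HQ & HP).
  set (W := fun a y => Q (scons a (fun _ => 0)) y).
  assert (HW : Bd (fun r => W (r 0%nat) (r 1%nat))).
  (* In [HQ] variable 0 is the witness and variable 1 the argument; [W] takes them in the opposite
     order, and all other variables are set to 0. *)
  { apply (Def_instantiate bounded _ (fun _ => 0)
      (fun i => match i with O => Some 1%nat | 1%nat => Some O | _ => None end)) in HQ.
    - revert HQ. apply Def_iff. intros r. unfold W.
      match goal with |- Q ?a _ <-> Q ?b _ => replace b with a; [tauto|] end.
      apply functional_extensionality; intros [|[|i]]; reflexivity.
    - intros [|[|i]] [|[|j]] k; congruence. }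
  assert (HPW : forall a, P a <-> exists y, W a y).
  { intros a. apply (HP (scons a (fun _ => 0))). }
  clearbody W. clear Q HQ HP.
  pose proof (fun t u => Def_subst2 bounded W t u HW) as HW'.
  (* [n] is the stage at which the first witness of [x] appears. *)
  set (first := fun n x => exists y, y <= n /\
    (n = pair x y /\ W x y /\ forall y', y' < y -> ~ W x y')).
  assert (first_fun : forall n x x', first n x -> first n x' -> x = x').
  { intros n x x' (y & _ & -> & _) (y' & _ & E & _). apply pair_inj in E. tauto. }
  assert (first_inj : forall n n' x, first n x -> first n' x -> n = n').
  { intros n n' x (y & _ & -> & Hy & Hm) (y' & _ & -> & Hy' & Hm').
    destruct (trichotomy y y') as [L|[->|L]]; auto.
    - destruct (Hm' y L Hy).
    - destruct (Hm y' L Hy'). }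
  set (G := fun n v => (exists x, x <= n /\ (first n x /\ v = x + x)) \/
    (~ (exists x, x <= n /\ first n x) /\ v = n + n + 1)).
  destruct (HR G) as [X HX].
  - unfold G, first. defn.
  - intros n. destruct (classic (exists x, x <= n /\ first n x)) as [(x & Hx & H)|H].
    + exists (x + x). left. eauto.
    + exists (n + n + 1). right. auto.
  - intros n u v [(x & Hx & F & ->)|[F ->]] [(x' & Hx' & F' & ->)|[F' ->]]; auto.
    + rewrite (first_fun n x x'); auto.
    + destruct F'. eauto.
    + destruct F. eauto.
  - intros n m v [(x & Hx & F & ->)|[F ->]] [(x' & Hx' & F' & E)|[F' E]].
    + apply double_inj in E as <-. eauto.
    + destruct (double_ne_odd _ _ E).
    + destruct (double_ne_odd _ _ (eq_sym E)).
    + apply add_cancel_r, double_inj in E. exact E.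
  - intros n v [(x & Hx & F & ->)|[F ->]]; auto. apply le_ex in Hx as [d ->].
    apply le_ex. exists (d + d + 1). ring.
  - destruct (Bd_comprehension (fun a => a + a ∈ X)) as [Y HY]; [defn|].
    exists Y. intros a. rewrite HY, HX, HPW. split.
    + intros [n [(x & Hx & (y & _ & _ & Hy & _) & E)|[_ E]]].
      * apply double_inj in E as ->. eauto.
      * destruct (double_ne_odd _ _ E).
    + intros [y0 Hy0].
      destruct (least_Sg (fun y => W a y) y0) as (y & Hy & Hm); auto.
      { apply Bd_Sg, HW'; tm. }
      exists (pair a y). left. exists a. split; [apply le_pair_l|]. split; auto.
      exists y. split; [apply le_pair_r|]. auto.
Qed.

(** The common core of the three reversals: FC-3 supplies the first alternative, FC-1 and FC-2 a
    Sigma^0_1 sequence of vertices from different components. *)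
Lemma arithmetical_comprehension_graphs :
  (forall V E : sets M, graph V E -> finite_components V E ->
    (forall x, x ∈ V) ->
    (exists X, infinite X /\ totally_disconnected V E X) \/
    exists H : N -> N -> Prop,
      (forall t u, Tm t -> Tm u -> Sg (fun r => H (t r) (u r))) /\
      (forall i, exists n, H i n) /\
      (forall i n m, H i n -> H i m -> n = m) /\
      (forall i j n m, i <> j -> H i n -> H j m ->
        ~ exists C, component V E C /\ n ∈ C /\ m ∈ C)) ->
  arithmetical_comprehension M.
Proof.
  intros H. apply sigma01_arithmetical_comprehension, sigma01_comprehension_ranges.
  intros G G1 G2 G3 G4 G5.
  destruct (injection_graph G G1) as (V & E & HV & HE & HG).
  destruct (H V E HG) as [(X & HX & HXd)|(D & D1 & D2 & D3 & D4)]; auto.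
  - apply (injection_finite_components G); auto.
  - apply (range_comprehension_pairs G G1 G2 G3 G4 G5 V E HV HE
      (fun n m => n < m /\ n ∈ X /\ m ∈ X)).
    + intros t u Ht Hu. sgdef.
    + intros n m (Hnm & Hn & Hm). split; auto. apply HXd; auto.
      intros ->. exact (lt_irrefl _ Hnm).
    + assert (U : forall b, exists n, b < n /\ n ∈ X).
      { intros b. apply NNPP. intros C. apply HX. exists (b + 1). intros x Hx.
        apply NNPP. intros L. apply C. exists x. split; auto. order. }
      intros b. destruct (U b) as (n & Hbn & Hn), (U n) as (m & Hnm & Hm).
      exists n, m. auto.
  - apply (range_comprehension_sequence G G1 G2 G3 G4 G5 V E HV HE D); auto.
Qed.

End Reversal.

(** * The exponent of 2 in a canonical index *)

Section CanonicalIndices.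
Context {M : structure} {HM : RCA0 M}.
Notation N := (num M).
Notation env := (nat -> num M).
Notation Bd := (Def bounded).
Add Ring num_ring : (num_semi_ring (M := M)).

Definition odd (n : N) : Prop := exists k, n = k + k + 1.

Lemma odd_mul (m n : N) : odd m -> odd n -> odd (m * n).
Proof.
  intros [k ->] [l ->]. exists (k * l + k * l + k + l). ring.
Qed.

Definition powers (x s y : N) : Prop :=
  item s 0 1 /\ forall j, j < y -> exists u, item s j u /\ item s (j + 1) (u * x).

Lemma powers_odd (x s y z : N) : odd x -> powers x s y -> item s y z -> odd z.
Proof.
  intros Hx [H0 HS] Hz.
  assert (A : forall j, y < j \/ exists k, item s j (k + k + 1)).
  { apply Sg_ind; [sgdef| |].
    - right. exists 0. rewrite !add_0_l. exact H0.
    - intros j [Hj|[k Hk]]; [left; order|].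
      destruct (classic (j < y)) as [Hj|Hj]; [right|left; order].
      destruct (HS j Hj) as (u & Hu & Hu').
      destruct (odd_mul u x) as [l El]; auto.
      + exists k. exact (item_unique _ _ _ _ Hu Hk).
      + exists l. rewrite <- El. exact Hu'. }
  destruct (A y) as [C|[k Hk]]; [destruct (lt_irrefl _ C)|].
  exists k. exact (item_unique _ _ _ _ Hz Hk).
Qed.

Lemma powers_nonzero (x s y z : N) : x <> 0 -> powers x s y -> item s y z -> z <> 0.
Proof.
  intros Hx [H0 HS] Hz.
  assert (A : forall j, y < j \/ exists k, item s j (k + 1)).
  { apply Sg_ind; [sgdef| |].
    - right. exists 0. rewrite !add_0_l. exact H0.
    - intros j [Hj|[k Hk]]; [left; order|].
      destruct (classic (j < y)) as [Hj|Hj]; [right|left; order].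
      destruct (HS j Hj) as (u & Hu & Hu').
      rewrite (item_unique _ _ _ _ Hu Hk) in Hu'.
      destruct (zero_or_succ x) as [->|[w ->]]; [tauto|].
      exists (k * w + k + w). replace (k * w + k + w + 1) with ((k + 1) * (w + 1)) by ring.
      exact Hu'. }
  destruct (A y) as [C|[k Hk]]; [destruct (lt_irrefl _ C)|].
  rewrite (item_unique _ _ _ _ Hz Hk). apply succ_ne_zero.
Qed.

Lemma powers_agree (x s y s' y' z : N) :
  powers x s y -> powers x s' y' -> y <= y' -> item s y z -> item s' y z.
Proof.
  intros [H0 HS] [H0' HS'] Hy Hz.
  assert (A : forall j, y < j \/ exists u, item s j u /\ item s' j u).
  { apply Sg_ind; [sgdef|right; eauto|].
    intros j [Hj|(u & Hu & Hu')]; [left; order|].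
    destruct (classic (j < y)) as [Hj|Hj]; [right|left; order].
    destruct (HS j Hj) as (v & Hv & Hvx).
    destruct (HS' j) as (v' & Hv' & Hvx'); [order|].
    rewrite (item_unique _ _ _ _ Hv Hu) in Hvx.
    rewrite (item_unique _ _ _ _ Hv' Hu') in Hvx'. eauto. }
  destruct (A y) as [C|(u & Hu & Hu')]; [destruct (lt_irrefl _ C)|].
  rewrite (item_unique _ _ _ _ Hz Hu). exact Hu'.
Qed.

Definition two_adic (c a : N) : Prop :=
  exists z w, power (1 + 1) a z /\ odd w /\ c = z * w.

(** For [a < b] the power [2^b] is [2^a] times an even number, as one sees along the coded
    computation of [2^b]. Cancelling [2^a] from the two factorizations of [c] equates an even and an
    odd number. *)
Lemma two_adic_lt (c a b : N) : two_adic c a -> two_adic c b -> ~ a < b.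
Proof.
  intros (z & w & (s & s0 & sS & sz) & Hw & Ec) (z' & w' & (s' & s0' & sS' & sz') & Hw' & Ec') H.
  assert (P : powers (1 + 1) s a) by (split; auto).
  assert (P' : powers (1 + 1) s' b) by (split; auto).
  pose proof (powers_agree _ _ _ _ _ _ P P' (or_introl H) sz) as Hz.
  apply lt_ex in H as [d ->].
  assert (A : forall e, d < e \/ exists r, item s' (a + e + 1) (z * (r + r))).
  { apply Sg_ind; [sgdef| |].
    - right. exists 1. destruct (sS' a) as (u & Hu & Hu').
      + apply lt_ex. exists d. reflexivity.
      + rewrite (item_unique _ _ _ _ Hu Hz) in Hu'. rewrite add_0_r. exact Hu'.
    - intros e [He|[r Hr]]; [left; order|].
      destruct (classic (e < d)) as [He|He]; [right|left; order].
      apply lt_ex in He as [f ->].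
      destruct (sS' (a + e + 1)) as (u & Hu & Hu').
      + apply lt_ex. exists f. ring.
      + rewrite (item_unique _ _ _ _ Hu Hr) in Hu'. exists (r + r).
        replace (z * (r + r + (r + r))) with (z * (r + r) * (1 + 1)) by ring.
        replace (a + (e + 1) + 1) with (a + e + 1 + 1) by ring. exact Hu'. }
  destruct (A d) as [C|[r Hr]]; [destruct (lt_irrefl _ C)|].
  rewrite (item_unique _ _ _ _ sz' Hr) in Ec'.
  destruct Hw as [k ->], Hw' as [l ->].
  apply (double_ne_odd (r * (l + l + 1)) k).
  apply (mul_cancel_l z).
  - apply (powers_nonzero (1 + 1) s a); auto. apply succ_ne_zero.
  - rewrite <- Ec, Ec'. ring.
Qed.

Lemma two_adic_unique (c a b : N) : two_adic c a -> two_adic c b -> a = b.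
Proof.
  intros Ha Hb. pose proof (two_adic_lt c a b Ha Hb).
  pose proof (two_adic_lt c b a Hb Ha). order.
Qed.

Lemma Sg_two_adic t u : Tm t -> Tm u -> Sg (fun r => two_adic (t r) (u r)).
Proof. intros. unfold two_adic, power, odd. sgdef. Qed.

(** Such a prime exceeds its predecessor in the list, which is greater than 1. If it were [2k],
    primality would give [k = 1], hence the value 2, which is too small. *)
Lemma nth_prime_odd (i p : N) : nth_prime (i + 1) p -> odd p.
Proof.
  intros (s & H0 & HS & Hp).
  assert (A : forall j, i + 1 < j \/ exists u, item s j u /\ 1 < u).
  { apply Sg_ind; [sgdef| |].
    - right. exists (1 + 1). split; auto. apply lt_succ_diag.
    - intros j [Hj|(u & Hu & Hu1)]; [left; order|].
      destruct (classic (j < i + 1)) as [Hj|Hj]; [right|left; order].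
      destruct (HS j Hj) as (u' & v & Hu' & Hv & Hn).
      exists v. split; auto. rewrite (item_unique _ _ _ _ Hu' Hu) in Hn.
      destruct Hn as (_ & Hn & _). order. }
  destruct (HS i (lt_succ_diag i)) as (u & v & Hu & Hv & Hpr & Huv & _).
  rewrite (item_unique _ _ _ _ Hp Hv). clear p Hp.
  destruct (A i) as [C|(u' & Hu' & Hu1)]; [order|].
  rewrite (item_unique _ _ _ _ Hu' Hu) in Hu1.
  destruct (parity v) as [k [E|E]]; [|exists k; exact E].
  destruct (proj2 Hpr (1 + 1) k) as [C|C].
  - rewrite E. ring.
  - pose proof (lt_succ_diag (1 : N)) as L. rewrite C in L. destruct (lt_irrefl _ L).
  - subst k. order.
Qed.

(** Since all primes but the first are odd, the exponent of 2 in a canonical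
    index is the least element of the set: unique factorization is not needed. *)
Lemma canonical_index_two_adic (X : sets M) (c : N) : canonical_index X c ->
  exists a, a ∈ X /\ (forall x, x ∈ X -> a <= x) /\ two_adic c a.
Proof.
  intros (s & k & t & [Hinc HX] & Ht0 & HS & Htk).
  destruct (HS 0 (le_0 k)) as (a & p & z & u & Ha & Hp & Hz & Hu & Hu').
  exists a.
  assert (B : forall i, k < i \/ exists v, item s i v /\ a <= v).
  { apply Sg_ind; [sgdef|right; eauto|].
    intros i [Hi|(v & Hv & Hav)]; [left; order|].
    destruct (classic (i < k)) as [Hi|Hi]; [right|left; order].
    destruct (Hinc i Hi) as (v' & w & Hv' & Hw & Hvw).
    rewrite (item_unique _ _ _ _ Hv' Hv) in Hvw. exists w. split; auto. order. }
  split; [|split].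
  - apply HX. exists 0. split; auto. apply le_0.
  - intros x Hx. apply HX in Hx as (i & Hi & Hx).
    destruct (B i) as [C|(v & Hv & Hav)]; [order|].
    rewrite (item_unique _ _ _ _ Hx Hv). exact Hav.
  - destruct Hp as (sp & Hp0 & _ & Hp).
    rewrite (item_unique _ _ _ _ Hp Hp0) in Hz.
    rewrite (item_unique _ _ _ _ Hu Ht0), mul_1_l, add_0_l in Hu'.
    assert (A : forall i, k < i \/ exists w, item t (i + 1) (z * (w + w + 1))).
    { apply Sg_ind; [sgdef| |].
      - right. exists 0. rewrite !add_0_l, mul_comm, mul_1_l. exact Hu'.
      - intros i [Hi|[w Hw]]; [left; order|].
        destruct (classic (i < k)) as [Hi|Hi]; [right|left; order].
        destruct (HS (i + 1)) as (a' & p' & z' & u' & Ha' & Hp' & (s' & P0 & PS & Pz) & H1 & H2);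
          [order|].
        apply nth_prime_odd in Hp'.
        assert (Hz' : odd z') by (apply (powers_odd p' s' a'); auto; split; auto).
        destruct (odd_mul (w + w + 1) z') as [l El]; [exists w; auto|auto|].
        exists l. rewrite (item_unique _ _ _ _ H1 Hw) in H2.
        rewrite <- El, mul_assoc. exact H2. }
    destruct (A k) as [C|[w Hw]]; [destruct (lt_irrefl _ C)|].
    exists z, (w + w + 1). split; [exact Hz|]. split; [exists w; auto|].
    exact (item_unique _ _ _ _ Htk Hw).
Qed.

Lemma FC1_arithmetical_comprehension : FC1 M -> arithmetical_comprehension M.
Proof.
  intros F. apply arithmetical_comprehension_graphs. intros V E HG HF _. right.
  destruct (F V E HG HF) as (d & (_ & Hd) & HC & Hne).
  exists (fun i n => exists c, pair i c ∈ d /\ two_adic c n).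
  split; [|split; [|split]].
  - intros t u Ht Hu. apply Sg_ex, Sg_and; [sgdef|]. apply Sg_two_adic; tm.
  - intros i. destruct (Hd i I) as (c & Hc & _).
    destruct (HC i c Hc) as (C & _ & Ci).
    destruct (canonical_index_two_adic C c Ci) as (a & _ & _ & Ha). eauto.
  - intros i n m (c & Hc & Hn) (c' & Hc' & Hm).
    destruct (Hd i I) as (c0 & _ & U).
    rewrite <- (U c Hc) in Hn. rewrite <- (U c' Hc') in Hm.
    exact (two_adic_unique _ _ _ Hn Hm).
  - intros i j n m Hij (c & Hc & Hn) (c' & Hc' & Hm) (D & HD & Dn & Dm).
    destruct (HC i c Hc) as (C & HCc & Ci), (HC j c' Hc') as (C' & HCc' & Ci').
    destruct (canonical_index_two_adic C c Ci) as (a & Ca & _ & Ha).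
    destruct (canonical_index_two_adic C' c' Ci') as (a' & Ca' & _ & Ha').
    rewrite (two_adic_unique _ _ _ Ha Hn) in Ca.
    rewrite (two_adic_unique _ _ _ Ha' Hm) in Ca'.
    apply (Hne i j c c' C C' Hij Hc Hc' Ci Ci').
    pose proof (component_same_set V E C D n HCc HD Ca Dn) as S.
    pose proof (component_same_set V E D C' m HD HCc' Dm Ca') as S'.
    intros x. rewrite (S x). apply S'.
Qed.

Lemma FC2_arithmetical_comprehension : FC2 M -> arithmetical_comprehension M.
Proof.
  intros F. apply arithmetical_comprehension_graphs. intros V E HG HF _. right.
  destruct (F V E HG HF) as (d & _ & HC & Hne).
  exists (fun i n => pair (pair i n) 1 ∈ d /\
    forall n', n' < n -> ~ pair (pair i n') 1 ∈ d).
  split; [|split; [|split]].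
  - intros t u Ht Hu. sgdef.
  - intros i. destruct (HC i) as (C & HCc & HCi). destruct HCc as [[x Hx] _].
    destruct (least_Sg (fun n => pair (pair i n) 1 ∈ d) x) as (n & Hn & Hm).
    + sgdef.
    + apply HCi, Hx.
    + eauto.
  - intros i n m [Hn Hn'] [Hm Hm'].
    destruct (trichotomy n m) as [L|[L|L]]; auto.
    + destruct (Hm' n L Hn).
    + destruct (Hn' m L Hm).
  - intros i j n m Hij [Hn _] [Hm _] (D & HD & Dn & Dm).
    destruct (HC i) as (C & HCc & HCi), (HC j) as (C' & HCc' & HCj).
    apply (Hne i j C C' Hij HCi HCj). apply HCi in Hn. apply HCj in Hm.
    pose proof (component_same_set V E C D n HCc HD Hn Dn) as S.
    pose proof (component_same_set V E D C' m HD HCc' Dm Hm) as S'.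
    intros x. rewrite (S x). apply S'.
Qed.

Lemma FC3_arithmetical_comprehension : FC3 M -> arithmetical_comprehension M.
Proof.
  intros F. apply arithmetical_comprehension_graphs. intros V E HG HF _. left.
  exact (F V E HG HF).
Qed.

End CanonicalIndices.

(** * Consequences of arithmetical comprehension *)

Section Forward.
Context {M : structure} {HM : RCA0 M} (AC : arithmetical_comprehension M).
Notation N := (num M).
Notation env := (nat -> num M).
Notation Ar := (Def arithmetical).
Add Ring num_ring : (num_semi_ring (M := M)).

Lemma one_ne_zero : (1 : N) <> 0.
Proof. rewrite <- (add_0_l 1). apply succ_ne_zero. Qed.

Lemma Ar_collection (P : N -> N -> Prop) n :
  (forall t u, Tm t -> Tm u -> Ar (fun r => P (t r) (u r))) ->
  (forall x, x < n -> exists y, P x y) ->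
  exists b, forall x, x < n -> exists y, y < b /\ P x y.
Proof.
  intros HP H.
  destruct (Ar_comprehension (fun z => exists x y, z = pair x y /\ P x y) AC) as [X HX];
    [defn|].
  assert (E : forall x y, P x y <-> pair x y ∈ X).
  { intros x y. rewrite HX. split; [eauto|].
    intros (x' & y' & Eq & Hxy). apply pair_inj in Eq as [-> ->]. exact Hxy. }
  destruct (collection (fun x y => pair x y ∈ X) n) as [b Hb]; [sgdef| |].
  - intros x Hx. destruct (H x Hx) as [y Hy]. exists y. apply E, Hy.
  - exists b. intros x Hx. destruct (Hb x Hx) as (y & Hy & Hxy).
    exists y. split; auto. apply E, Hxy.
Qed.

(** A coded iteration of [R] from [a], where [R] may depend on the stage. Enumerations, the list of
    primes, powers and the partial products of canonical indices are all obtained as runs. *)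
Definition run (R : N -> N -> N -> Prop) (a s i : N) : Prop :=
  item s 0 a /\ forall j, j < i ->
    exists u v, item s j u /\ item s (j + 1) v /\ R j u v.

Lemma run_exists (R : N -> N -> N -> Prop) a :
  (forall t u w, Tm t -> Tm u -> Tm w -> Ar (fun r => R (t r) (u r) (w r))) ->
  (forall j u, exists v, R j u v) ->
  forall i, exists s v, run R a s i /\ item s i v.
Proof.
  intros HR tot. apply (Ar_ind _ AC); [unfold run; defn| |].
  - destruct (append 0 0 a) as (s & _ & Hs). exists s, a. repeat split; auto.
    intros j Hj. destruct (nlt_0 _ Hj).
  - intros i (s & u & [H0 HS] & Hu). destruct (tot i u) as [v Hv].
    destruct (append s (i + 1) v) as (s' & Hs & Hs').
    exists s', v. split; auto. split.
    + apply Hs; auto. apply lt_ex. exists i. ring.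
    + intros j Hj. apply lt_succ in Hj as [Hj| ->].
      * destruct (HS j Hj) as (u' & v' & Hu' & Hv' & Hr). exists u', v'.
        split; [|split; auto]; apply Hs; auto; [order|apply succ_lt_mono, Hj].
      * exists u, v. split; [|split]; auto. apply Hs; auto. order.
Qed.

Lemma run_agree R a s s' i v :
  (forall j u w w', R j u w -> R j u w' -> w = w') ->
  run R a s i -> run R a s' i -> item s i v -> item s' i v.
Proof.
  intros HR [H0 HS] [H0' HS'] Hv.
  assert (A : forall j, i < j \/ exists u, item s j u /\ item s' j u).
  { apply Sg_ind; [sgdef|right; eauto|].
    intros j [Hj|(u & Hu & Hu')]; [left; order|].
    destruct (classic (j < i)) as [Hj|Hj]; [right|left; order].
    destruct (HS j Hj) as (x & y & Hx & Hy & Hr).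
    destruct (HS' j Hj) as (x' & y' & Hx' & Hy' & Hr').
    rewrite (item_unique _ _ _ _ Hx Hu) in Hr.
    rewrite (item_unique _ _ _ _ Hx' Hu') in Hr'.
    rewrite (HR _ _ _ _ Hr' Hr) in Hy'. eauto. }
  destruct (A i) as [C|(u & Hu & Hu')]; [destruct (lt_irrefl _ C)|].
  rewrite (item_unique _ _ _ _ Hv Hu). exact Hu'.
Qed.

Lemma run_increasing R a s i j u v :
  (forall j u w, R j u w -> u < w) -> run R a s j ->
  item s i u -> item s j v -> i < j -> u < v.
Proof.
  intros HR [_ HS] Hu Hv Hij. apply lt_ex in Hij as [d ->].
  assert (A : forall e, d < e \/ exists w, item s (i + e + 1) w /\ u < w).
  { apply Sg_ind; [sgdef| |].
    - right. destruct (HS i) as (x & w & Hx & Hw & Hr).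
      + apply lt_ex. exists d. reflexivity.
      + exists w. rewrite add_0_r. split; auto.
        rewrite (item_unique _ _ _ _ Hu Hx). eauto.
    - intros e [He|(w & Hw & Huw)]; [left; order|].
      destruct (classic (e < d)) as [He|He]; [right|left; order].
      apply lt_ex in He as [f ->].
      destruct (HS (i + e + 1)) as (x & y & Hx & Hy & Hr).
      + apply lt_ex. exists f. ring.
      + exists y. replace (i + (e + 1) + 1) with (i + e + 1 + 1) by ring.
        split; auto. apply HR in Hr. rewrite (item_unique _ _ _ _ Hx Hw) in Hr. order. }
  destruct (A d) as [C|(w & Hw & H)]; [destruct (lt_irrefl _ C)|].
  rewrite (item_unique _ _ _ _ Hv Hw). exact H.
Qed.

(** Each stage moves to the least element of [Q] above the previous one. Runs agree where both are
    defined and increase strictly, which makes the enumeration single-valued and injective. *)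
Lemma increasing_enumeration (Q : N -> Prop) :
  (forall t, Tm t -> Ar (fun r => Q (t r))) ->
  (forall b, exists x, b < x /\ Q x) ->
  exists e : N -> N -> Prop,
    (forall t u, Tm t -> Tm u -> Ar (fun r => e (t r) (u r))) /\
    (forall i, exists x, e i x) /\
    (forall i x y, e i x -> e i y -> x = y) /\
    (forall i j x, e i x -> e j x -> i = j) /\
    (forall i x, e i x -> Q x).
Proof.
  intros HQ unb.
  set (R := fun _ u v : N => (u < v /\ Q v) /\ forall w, w < v -> ~ (u < w /\ Q w)).
  assert (HR : forall t u w, Tm t -> Tm u -> Tm w -> Ar (fun r => R (t r) (u r) (w r))).
  { intros t u w Ht Hu Hw. unfold R. defn. }
  assert (Rtot : forall j u, exists v, R j u v).
  { intros j u. destruct (unb u) as [x Hx].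
    destruct (least_Ar (fun v => u < v /\ Q v) x AC) as (v & Hv & Hm); [defn|auto|].
    exists v. split; auto. }
  assert (Rfun : forall j u w w', R j u w -> R j u w' -> w = w').
  { intros j u w w' [H H1] [H' H1'].
    destruct (trichotomy w w') as [L|[L|L]]; auto.
    - destruct (H1' w L H).
    - destruct (H1 w' L H'). }
  assert (Rinc : forall j u w, R j u w -> u < w) by (intros j u w H; apply H).
  (* Item 0 is the starting value 0, which need not satisfy [Q], so the enumeration begins at item
     1. *)
  exists (fun i x => exists s, run R 0 s (i + 1) /\ item s (i + 1) x).
  split; [|split; [|split; [|split]]].
  - intros t u Ht Hu. unfold run. defn.
  - intros i. destruct (run_exists R 0 HR Rtot (i + 1)) as (s & v & Hs). eauto.
  - intros i x y (s & Hs & Hx) (s' & Hs' & Hy).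
    apply (run_agree R 0 s s' _ _ Rfun Hs Hs') in Hx.
    exact (item_unique _ _ _ _ Hx Hy).
  - assert (L : forall i j x s s', i < j -> run R 0 s (i + 1) -> item s (i + 1) x ->
      run R 0 s' (j + 1) -> item s' (j + 1) x -> False).
    { intros i j x s s' Hij Hs Hx Hs' Hy. apply succ_lt_mono in Hij.
      assert (Hs'' : run R 0 s' (i + 1)).
      { destruct Hs' as [H0 HS]. split; auto. intros k Hk. apply HS.
        exact (lt_trans _ _ _ Hk Hij). }
      apply (run_agree R 0 s s' _ _ Rfun Hs Hs'') in Hx.
      exact (lt_irrefl x (run_increasing R 0 s' _ _ _ _ Rinc Hs' Hx Hy Hij)). }
    intros i j x (s & Hs & Hx) (s' & Hs' & Hy).
    destruct (trichotomy i j) as [H|[H|H]]; auto.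
    + destruct (L i j x s s'); auto.
    + destruct (L j i x s' s); auto.
  - intros i x (s & [_ HS] & Hx).
    destruct (HS i (lt_succ_diag i)) as (u & v & _ & Hv & [[_ H] _]).
    rewrite (item_unique _ _ _ _ Hx Hv). exact H.
Qed.

(** * Existence of canonical indices *)

(** Euclid's argument with a common multiple [L] of the numbers up to [n]: the least divisor of
    [L + 1] above 1 is prime, and it cannot be at most [n], as it would then divide 1. *)
Lemma prime_unbounded (n : N) : exists p, prime p /\ n < p.
Proof.
  destruct (common_multiple 1 0 n) as (L & HL & Hdiv).
  destruct (least_Ar (fun q => 1 < q /\ exists y, L + 1 = q * y) (L + 1) AC)
    as (q & [Hq [y Hy]] & Hmin).
  - defn.
  - split; [|exists 1; ring].
    destruct (zero_or_succ L) as [->|[l ->]]; [tauto|]. apply lt_ex. exists l. ring.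
  - exists q. split; [split; auto|].
    + intros a b E. apply NNPP. intros C. apply not_or_and in C as [Ca Cb].
      destruct (zero_or_succ b) as [->|[b' Eb]].
      { rewrite mul_0_r in E. subst q. destruct (nlt_0 _ Hq). }
      destruct (zero_or_succ a) as [->|[a' Ea]].
      { rewrite mul_0_l in E. subst q. destruct (nlt_0 _ Hq). }
      destruct (zero_or_succ a') as [->|[a'' ->]]; [apply Ca; rewrite Ea; ring|].
      destruct (zero_or_succ b') as [->|[b'' ->]]; [apply Cb; rewrite Eb; ring|].
      apply (Hmin a).
      * rewrite E, Eb, Ea. apply lt_ex. exists (b'' * (a'' + 1 + 1) + a'' + 1). ring.
      * split; [rewrite Ea; apply lt_ex; exists a''; ring|].
        exists (b * y). rewrite Hy, E. ring.
    + apply NNPP. intros C. destruct (zero_or_succ q) as [->|[e ->]].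
      { destruct (nlt_0 _ Hq). }
      destruct (Hdiv e) as [k Hk]; [order|].
      replace (1 + e * 1 + 0) with (e + 1) in Hk by ring.
      rewrite Hk in Hy. destruct (trichotomy y k) as [H|[->|H]].
      * apply lt_ex in H as [d ->]. apply (succ_ne_zero ((e + 1) * d + e + 1)).
        apply (add_cancel_l _ _ ((e + 1) * y)). rewrite add_0_r.
        etransitivity; [|exact Hy]. ring.
      * apply one_ne_zero, (add_cancel_l _ _ ((e + 1) * k)). rewrite add_0_r. exact Hy.
      * apply lt_ex in H as [d ->].
        assert (E : 1 = e + 1 + (e + 1) * d).
        { apply (add_cancel_l _ _ ((e + 1) * k)). rewrite Hy. ring. }
        pose proof (le_add_l (e + 1) ((e + 1) * d)) as Hle.
        rewrite <- E in Hle. order.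
Qed.

Lemma Ar_prime (t : env -> N) : Tm t -> Ar (fun r => prime (t r)).
Proof. intros. unfold prime. defn. Qed.
Hint Extern 1 (Def _ _) => apply Ar_prime : defn.

Lemma Ar_next_prime (t u : env -> N) : Tm t -> Tm u ->
  Ar (fun r => next_prime (t r) (u r)).
Proof. intros. unfold next_prime. defn. Qed.
Hint Extern 1 (Def _ _) => apply Ar_next_prime : defn.

Lemma Ar_nth_prime (t u : env -> N) : Tm t -> Tm u -> Ar (fun r => nth_prime (t r) (u r)).
Proof. intros. unfold nth_prime. defn. Qed.
Hint Extern 1 (Def _ _) => apply Ar_nth_prime : defn.

Lemma Ar_power (t u w : env -> N) : Tm t -> Tm u -> Tm w ->
  Ar (fun r => power (t r) (u r) (w r)).
Proof. intros. unfold power. defn. Qed.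
Hint Extern 1 (Def _ _) => apply Ar_power : defn.

Lemma next_prime_exists (p : N) : exists q, next_prime p q.
Proof.
  destruct (prime_unbounded p) as (q0 & H).
  destruct (least_Ar (fun q => prime q /\ p < q) q0 AC) as (q & [Hq Hpq] & Hm);
    [defn|auto|].
  exists q. split; [|split]; auto. intros r Hr Hpr.
  assert (~ r < q) by (intros L; exact (Hm r L (conj Hr Hpr))). order.
Qed.

Lemma nth_prime_exists (i : N) : exists p, nth_prime i p.
Proof.
  destruct (run_exists (fun _ u v => next_prime u v) (1 + 1)) with (i := i)
    as (s & p & [H0 HS] & Hp).
  - intros t u w Ht Hu Hw. defn.
  - intros _. apply next_prime_exists.
  - exists p, s. auto.
Qed.

Lemma power_exists (x y : N) : exists z, power x y z.
Proof.
  destruct (run_exists (fun _ u v => v = u * x) 1) with (i := y)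
    as (s & z & [H0 HS] & Hz).
  - intros t u w Ht Hu Hw. defn.
  - eauto.
  - exists z, s. repeat split; auto. intros j Hj.
    destruct (HS j Hj) as (u & v & Hu & Hv & ->). eauto.
Qed.

(** Induction on a cut-off [b], enumerating the elements below it. Since [k] is the last index, an
    enumeration is never empty, so the stages before the first element form a separate case. *)
Lemma enumerates_exists (X : sets M) : (exists x, x ∈ X) -> finite X ->
  exists s k, enumerates s k X /\ forall i, i <= k -> exists a, item s i a.
Proof.
  intros [x0 Hx0] [b Hb].
  assert (A : forall b, (forall x, x ∈ X -> b <= x) \/ exists s k,
    (forall i, i < k -> exists u v, item s i u /\ item s (i + 1) v /\ u < v) /\
    (forall i, i <= k -> exists a, item s i a) /\
    (forall x, x ∈ X /\ x < b <-> exists i, i <= k /\ item s i x)).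
  { clear b Hb. apply (Ar_ind _ AC); [defn|left; intros; apply le_0|].
    intros b IH. destruct (classic (b ∈ X)) as [Xb|Xb].
    - right. destruct IH as [E|(s & k & Hi & Ht & HX)].
      + destruct (append 0 0 b) as (s & _ & Hs). exists s, 0. split; [|split].
        * intros i Hi. destruct (nlt_0 _ Hi).
        * intros i [Hi| ->]; [destruct (nlt_0 _ Hi)|eauto].
        * intros x. split.
          -- intros [Xx Hx]. exists 0. split; auto. specialize (E x Xx).
             replace x with b by order. exact Hs.
          -- intros (i & [Hi| ->] & Hx); [destruct (nlt_0 _ Hi)|].
             rewrite (item_unique _ _ _ _ Hx Hs). split; auto. apply lt_succ_diag.
      + destruct (append s (k + 1) b) as (s' & Hs & Hb). exists s', (k + 1).
        assert (Hs' : forall i u, i <= k -> item s i u -> item s' i u).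
        { intros i u Hik. apply Hs. order. }
        assert (Ht' : forall i, i <= k -> forall u, item s' i u -> item s i u).
        { intros i Hik u Hu. destruct (Ht i Hik) as [a Ha].
          rewrite (item_unique _ _ _ _ Hu (Hs' i a Hik Ha)). exact Ha. }
        split; [|split].
        * intros i Hik. apply lt_succ in Hik as [Hik| ->].
          -- destruct (Hi i Hik) as (u & v & Hu & Hv & Huv). exists u, v.
             split; [apply Hs'; auto|]. split; auto. apply Hs; auto.
             apply succ_lt_mono, Hik.
          -- destruct (Ht k) as [u Hu]; auto. exists u, b. split; auto. split; auto.
             apply HX. eauto.
        * intros i [Hik| ->]; [|eauto]. apply lt_succ in Hik.
          destruct (Ht i Hik) as [a Ha]. eauto.
        * intros x. split.
          -- intros [Xx Hx]. apply lt_succ in Hx as [Hx| ->]; [|eauto].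
             destruct (proj1 (HX x)) as (i & Hik & Hix); auto.
             exists i. split; auto. order.
          -- intros (i & [Hik| ->] & Hx).
             ++ apply lt_succ in Hik. destruct (proj2 (HX x)) as [Xx Hxb].
                ** exists i. split; auto.
                ** split; auto. order.
             ++ rewrite (item_unique _ _ _ _ Hx Hb). split; auto. apply lt_succ_diag.
    - destruct IH as [E|(s & k & Hi & Ht & HX)].
      + left. intros x Xx. specialize (E x Xx).
        assert (x <> b) by congruence. order.
      + right. exists s, k. split; [|split]; auto. intros x. rewrite <- HX.
        split; intros [Xx Hx]; split; auto; [|order].
        assert (x <> b) by congruence. order. }
  destruct (A b) as [C|(s & k & Hi & Ht & HX)].
  - specialize (C x0 Hx0). specialize (Hb x0 Hx0). order.
  - exists s, k. split; auto. split; auto. intros x. rewrite <- HX. split; [auto|tauto].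
Qed.

Lemma canonical_index_exists (X : sets M) : (exists x, x ∈ X) -> finite X ->
  exists c, canonical_index X c.
Proof.
  intros HX0 HXf. destruct (enumerates_exists X HX0 HXf) as (s & k & Hs & Ht).
  (* The guard [i <= k] makes the relation total; beyond [k] any value is allowed. *)
  destruct (run_exists (fun i u v => i <= k -> exists a p z,
    item s i a /\ nth_prime i p /\ power p a z /\ v = u * z) 1) with (i := k + 1)
    as (t & c & [H0 HS] & Hc).
  - intros t u w Ht' Hu Hw. defn.
  - intros i u. destruct (classic (i <= k)) as [Hi|Hi]; [|exists 0; tauto].
    destruct (Ht i Hi) as [a Ha], (nth_prime_exists i) as [p Hp],
      (power_exists p a) as [z Hz].
    exists (u * z). intros _. exists a, p, z. auto.
  - exists c, s, k, t. split; [|split; [|split]]; auto.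
    intros i Hi. destruct (HS i) as (u & v & Hu & Hv & H); [order|].
    destruct (H Hi) as (a & p & z & Ha & Hp & Hz & ->).
    exists a, p, z, u. auto 6.
Qed.

(** [canonical_index] for a set given by a predicate, so that the definition
    is arithmetical. *)
Definition index_of (P : N -> Prop) (d : N) : Prop :=
  exists s k t,
    ((forall i, i < k -> exists u v, item s i u /\ item s (i + 1) v /\ u < v) /\
     (forall x, P x <-> exists i, i <= k /\ item s i x)) /\
    item t 0 1 /\
    (forall i, i <= k -> exists a p z u,
       item s i a /\ nth_prime i p /\ power p a z /\
       item t i u /\ item t (i + 1) (u * z)) /\
    item t (k + 1) d.

Lemma index_of_set (P : N -> Prop) (X : sets M) d :
  (forall x, x ∈ X <-> P x) -> (index_of P d <-> canonical_index X d).
Proof.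
  intros H. split.
  - intros (s & k & t & [A B] & C). exists s, k, t. split; auto.
    split; auto. intros x. rewrite H. apply B.
  - intros (s & k & t & [A B] & C). exists s, k, t. split; auto.
    split; auto. intros x. rewrite <- H. apply B.
Qed.

(** * Least elements of components *)

Section Representatives.
Context (V E : sets M) (HG : graph V E) (HF : finite_components V E).

Lemma Ar_joined t u : Tm t -> Tm u -> Ar (fun r => joined E (t r) (u r)).
Proof. intros. unfold joined. defn. Qed.
Hint Extern 1 (Def _ _) => apply Ar_joined : defn.

Lemma component_joined x : x ∈ V ->
  exists C, component V E C /\ finite C /\ forall y, y ∈ C <-> joined E x y.
Proof.
  intros Hx. destruct (HF x Hx) as (C & HC & Cx & Cf). exists C.
  split; [|split]; auto. destruct HC as (_ & _ & J & K). intros y. split; eauto.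
Qed.

Lemma joined_sym x y : x ∈ V -> joined E x y -> joined E y x.
Proof.
  intros Hx H. destruct (component_joined x Hx) as (C & (_ & _ & J & _) & _ & HC).
  apply J; apply HC; auto using joined_refl.
Qed.

Lemma joined_trans x y z : x ∈ V -> joined E x y -> joined E y z -> joined E x z.
Proof.
  intros Hx H H'. destruct (component_joined x Hx) as (C & (_ & _ & _ & K) & _ & HC).
  apply HC. apply (K y); auto. apply HC, H.
Qed.

Definition representative (x : N) : Prop :=
  x ∈ V /\ forall y, y < x -> ~ (y ∈ V /\ joined E y x).

Lemma Ar_representative t : Tm t -> Ar (fun r => representative (t r)).
Proof. intros. unfold representative. defn. Qed.
Hint Extern 1 (Def _ _) => apply Ar_representative : defn.

Lemma representative_exists x : x ∈ V ->
  exists m, representative m /\ joined E m x.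
Proof.
  intros Hx.
  destruct (least_Ar (fun m => m ∈ V /\ joined E m x) x AC) as (m & [Hm Hmx] & Hmin).
  - defn.
  - auto using joined_refl.
  - exists m. split; auto. split; auto. intros y Hy [Vy Hym].
    apply (Hmin y Hy). split; auto. apply (joined_trans y m x); auto.
Qed.

Lemma representative_unique x y :
  representative x -> representative y -> joined E x y -> x = y.
Proof.
  intros [Vx Hx] [Vy Hy] H. destruct (trichotomy x y) as [L|[L|L]]; auto.
  - destruct (Hy x L). auto.
  - destruct (Hx y L). auto using joined_sym.
Qed.

(** If the representatives were bounded, collection would give one bound for all their components.
    These cover [V], which is infinite. *)
Lemma representative_unbounded b : exists x, b < x /\ representative x.
Proof.
  apply NNPP. intros C.
  assert (Hb : forall x, representative x -> x < b + 1).
  { intros x Hx. apply NNPP. intros L. apply C. exists x. split; auto. order. }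
  destruct (Ar_collection (fun m c => representative m ->
    forall y, joined E m y -> y < c) (b + 1)) as [B HB].
  - intros t u Ht Hu. defn.
  - intros x _. destruct (classic (representative x)) as [Hx|Hx].
    + destruct (component_joined x (proj1 Hx)) as (D & _ & [c Hc] & HD).
      exists c. intros _ y Hy. apply Hc, HD, Hy.
    + exists 0. tauto.
  - apply (proj1 HG). exists B. intros x Hx.
    destruct (representative_exists x Hx) as (m & Hm & Hmx).
    destruct (HB m (Hb m Hm)) as (c & Hc & H). exact (lt_trans _ _ _ (H Hm x Hmx) Hc).
Qed.

Lemma infinite_totally_disconnected :
  exists X : sets M, infinite X /\ totally_disconnected V E X.
Proof.
  destruct (Ar_comprehension representative AC) as [X HX]; [defn|].
  exists X. split; [|split].
  - intros [b Hb]. destruct (representative_unbounded b) as (x & Hbx & Hx).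
    apply HX, Hb in Hx. order.
  - intros x Hx. apply HX in Hx. apply Hx.
  - intros x y Hx Hy Hxy (C & (_ & _ & J & _) & Cx & Cy). apply Hxy.
    apply HX in Hx, Hy. apply representative_unique; auto.
Qed.

Lemma component_sequence : exists e : N -> N -> Prop,
  (forall t u, Tm t -> Tm u -> Ar (fun r => e (t r) (u r))) /\
  (forall i, exists x, e i x) /\
  (forall i x y, e i x -> e i y -> x = y) /\
  (forall i x, e i x -> x ∈ V) /\
  (forall i j x y, i <> j -> e i x -> e j y -> ~ joined E x y).
Proof.
  destruct (increasing_enumeration representative) as (e & H1 & H2 & H3 & H4 & H5).
  - intros t Ht. defn.
  - exact representative_unbounded.
  - exists e. split; [|split; [|split; [|split]]]; auto.
    + intros i x Hx. apply (H5 i x Hx).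
    + intros i j x y Hij Hx Hy Hxy. apply Hij.
      rewrite (representative_unique x y) in Hx; eauto.
Qed.

Lemma distinct_components : exists F : sets M,
  function is_pair is_bit F /\
  (forall i, exists C, component V E C /\
     forall n, n ∈ C <-> pair (pair i n) 1 ∈ F) /\
  (forall i j C C', i <> j ->
     (forall n, n ∈ C <-> pair (pair i n) 1 ∈ F) ->
     (forall n, n ∈ C' <-> pair (pair j n) 1 ∈ F) ->
     ~ same_set C C').
Proof.
  destruct component_sequence as (e & H1 & H2 & H3 & H4 & H5).
  set (W := fun i n => exists x, e i x /\ joined E x n).
  destruct (Ar_comprehension (fun z => exists i n,
    (z = pair (pair i n) 1 /\ W i n) \/ (z = pair (pair i n) 0 /\ ~ W i n)) AC)
    as [F HF']; [unfold W; defn|].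
  assert (F1 : forall i n, pair (pair i n) 1 ∈ F <-> W i n).
  { intros i n. rewrite HF'. split.
    - intros (i' & n' & [[Eq H]|[Eq H]]).
      + apply pair_inj in Eq as [Eq _]. apply pair_inj in Eq as [-> ->]. exact H.
      + apply pair_inj in Eq as [_ Eq]. destruct (one_ne_zero Eq).
    - intros H. exists i, n. auto. }
  assert (F0 : forall i n, pair (pair i n) 0 ∈ F <-> ~ W i n).
  { intros i n. rewrite HF'. split.
    - intros (i' & n' & [[Eq H]|[Eq H]]).
      + apply pair_inj in Eq as [_ Eq]. destruct (one_ne_zero (eq_sym Eq)).
      + apply pair_inj in Eq as [Eq _]. apply pair_inj in Eq as [-> ->]. exact H.
    - intros H. exists i, n. auto. }
  assert (HW : forall i x n, e i x -> (W i n <-> joined E x n)).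
  { intros i x n Hx. split; [|intros; exists x; auto].
    intros (x' & Hx' & H). rewrite (H3 i x x'); auto. }
  exists F. split; [split|split].
  - intros z Hz. apply HF' in Hz as (i & n & [[-> _]|[-> _]]).
    + exists (pair i n), 1. unfold is_pair, is_bit. eauto 7.
    + exists (pair i n), 0. unfold is_pair, is_bit. eauto 7.
  - intros z (i & n & ->). destruct (classic (W i n)) as [H|H].
    + exists 1. split; [apply F1; auto|]. intros y Hy.
      apply HF' in Hy as (i' & n' & [[Eq Hy]|[Eq Hy]]); apply pair_inj in Eq as [Eq ->];
        auto. apply pair_inj in Eq as [-> ->]. tauto.
    + exists 0. split; [apply F0; auto|]. intros y Hy.
      apply HF' in Hy as (i' & n' & [[Eq Hy]|[Eq Hy]]); apply pair_inj in Eq as [Eq ->];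
        auto. apply pair_inj in Eq as [-> ->]. tauto.
  - intros i. destruct (H2 i) as [x Hx].
    destruct (component_joined x (H4 i x Hx)) as (C & HC & _ & HCx).
    exists C. split; auto. intros n. rewrite HCx, F1, (HW i x); tauto.
  - intros i j C C' Hij HC HC' S. destruct (H2 i) as [x Hx], (H2 j) as [y Hy].
    apply (H5 j i y x); auto. rewrite <- (HW j), <- F1, <- HC' by auto.
    apply S, HC, F1. exists x. auto using joined_refl.
Qed.

Lemma distinct_canonical_indices : exists d : sets M,
  function is_num is_num d /\
  (forall i c, pair i c ∈ d ->
     exists C, component V E C /\ canonical_index C c) /\
  (forall i j c c' C C', i <> j -> pair i c ∈ d -> pair j c' ∈ d ->
     canonical_index C c -> canonical_index C' c' -> ~ same_set C C').
Proof.
  destruct component_sequence as (e & H1 & H2 & H3 & H4 & H5).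
  (* [index_of] is only a relation between a set and a number; taking the least [c] makes [d]
     single-valued. *)
  set (W := fun i c => exists x, e i x /\ index_of (joined E x) c /\
    forall c', c' < c -> ~ index_of (joined E x) c').
  destruct (Ar_comprehension (fun z => exists i c, z = pair i c /\ W i c) AC)
    as [d Hd]; [unfold W, index_of; defn|].
  assert (Hd' : forall i c, pair i c ∈ d <-> W i c).
  { intros i c. rewrite Hd. split; [|eauto].
    intros (i' & c' & Eq & H). apply pair_inj in Eq as [-> ->]. exact H. }
  assert (HWx : forall i c, W i c -> exists x C, e i x /\ component V E C /\
    (forall y, y ∈ C <-> joined E x y) /\ canonical_index C c).
  { intros i c (x & Hx & Hc & _).
    destruct (component_joined x (H4 i x Hx)) as (C & HC & _ & HCx).
    exists x, C. repeat split; auto; try apply HCx; try apply HC.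
    apply (index_of_set (joined E x)); auto. }
  exists d. split; [split|split].
  - intros z Hz. apply Hd in Hz as (i & c & -> & _). exists i, c. repeat split.
  - intros i _. destruct (H2 i) as [x Hx].
    destruct (component_joined x (H4 i x Hx)) as (C & HC & Cf & HCx).
    destruct (canonical_index_exists C) as [c0 Hc0]; [apply HC|auto|].
    destruct (least_Ar (index_of (joined E x)) c0 AC) as (c & Hc & Hm).
    + unfold index_of. defn.
    + apply (index_of_set _ C); auto.
    + exists c. split; [apply Hd'; exists x; auto|]. intros c' Hc'.
      apply Hd' in Hc' as (x' & Hx' & Hc' & Hm').
      rewrite (H3 i x' x Hx' Hx) in Hc', Hm'.
      destruct (trichotomy c c') as [L|[L|L]]; auto.
      * destruct (Hm' c L Hc).
      * destruct (Hm c' L Hc').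
  - intros i c Hc. apply Hd', HWx in Hc as (x & C & _ & HC & _ & Hc). eauto.
  - intros i j c c' C C' Hij Hc Hc' HCc HCc' S.
    apply Hd', HWx in Hc as (x & D & Hx & HD & HDx & HDc).
    apply Hd', HWx in Hc' as (y & D' & Hy & HD' & HDy & HDc').
    (* [C] and [C'] are any sets with these indices, not necessarily the components [D] and [D'].
       The exponent of 2 in [c] is an element of both [C] and [D], and likewise for [c']. If [C] and
       [C'] have the same elements, their least elements coincide, and [D] and [D'] meet. *)
    destruct (canonical_index_two_adic C c HCc) as (a & Ca & Cm & Ha).
    destruct (canonical_index_two_adic D c HDc) as (b & Db & _ & Hb).
    destruct (canonical_index_two_adic C' c' HCc') as (a' & Ca' & Cm' & Ha').
    destruct (canonical_index_two_adic D' c' HDc') as (b' & Db' & _ & Hb').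
    rewrite (two_adic_unique _ _ _ Hb Ha) in Db.
    rewrite (two_adic_unique _ _ _ Hb' Ha') in Db'.
    assert (Eq : a = a').
    { assert (a <= a') by (apply Cm, S, Ca').
      assert (a' <= a) by (apply Cm', S, Ca). order. }
    subst a'. apply (H5 i j x y); auto.
    apply HDx, (component_same_set V E D' D a); auto.
    apply HDy, joined_refl.
Qed.

End Representatives.

End Forward.

Theorem theorem4p4 (M : structure) (hM : RCA0 M) :
  (ACA0 M <-> FC1 M) /\ (ACA0 M <-> FC2 M) /\ (ACA0 M <-> FC3 M).
Proof.
  split; [|split]; split.
  - intros [_ AC] V E HG HF. apply distinct_canonical_indices; assumption.
  - intros F. split; [exact hM|]. apply FC1_arithmetical_comprehension, F.
  - intros [_ AC] V E HG HF. apply distinct_components; assumption.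
  - intros F. split; [exact hM|]. apply FC2_arithmetical_comprehension, F.
  - intros [_ AC] V E HG HF. apply infinite_totally_disconnected; assumption.
  - intros F. split; [exact hM|]. apply FC3_arithmetical_comprehension, F.
Qed.
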